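(* Let $F=\mathbb{F}_{32}=\mathbb{F}_2[X]/(X^5+X^2+1)$ and $\omega=X \bmod (X^5+X^2+1)$. Let $G=[\,R\ \ I_7\,]\in F^{7\times 11}$, where $$R=\begin{pmatrix} \omega^4+\omega^2 & \omega^2+\omega+1 & \omega^4+\omega^2+\omega & 0\\ \omega^4 & \omega^4+\omega^3+1 & \omega^4+\omega^3+\omega^2+\omega & 0\\ \omega^3+\omega & \omega^2 & \omega^4+\omega & \omega\\ \omega^3+\omega & \omega^3+\omega^2+\omega+1 & \omega^2+1 & \omega^2\\ \omega^4+\omega^3+\omega+1 & \omega^4 & \omega^4+\omega^2+1 & \omega^3\\ \omega^4+\omega+1 & \omega^4 & \omega^4+\omega^2+\omega+1 & \omega^4\\ \omega^4+1 & \omega^4 & \omega^2+1 & 0 \end{pmatrix}.$$ Then the $\mathbb{F}_2$-span of the eleven columns of $G$ is an extremal $2$-scattered $[11,7]_{2^5/2}$ $q$-system (with $q=2$, $m=5$). Let $C$ be the $F$-row space of $G$. Then $C$ is a nondegenerate $[11,7,2]_{2^5/2}$ quasi-MRD code, and $D:=C^\perp$, which equals the $F$-row space of the matrix $H_B$ defined in the context, is a nondegenerate $[11,4,4]_{2^5/2}$ quasi-MRD code with $d_2(D)=6$. Its complete generalized rank-weight hierarchy is $$(d_1(D),d_2(D),d_3(D),d_4(D))=(4,6,9,11).$$ Consequently, the constructed $q$-system is inequivalent to every $q$-system associated with $D_{(s_1,s_2)}^\perp$, where $s_1+s_2=1$ and $D_{(s_1,s_2)}$ is an order-one direct-sum code.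 Furthermore, $D$ is not rank-metric equivalent to any nontrivial direct sum.
   Context: Here $q=2$, $m=5$. Matrix $H_B$. Put $\xi_i=\omega^{i-1}$ for $1\le i\le5$ and $$c_i=(\xi_i,0,\xi_i^{2},\xi_i^{4})^\top,\quad d_i=(0,\xi_i,\xi_i^{4},\xi_i^{2}+\xi_i^{4})^\top,\quad z=(0,0,1,0)^\top;$$ $H_B\in F^{4\times11}$ is the matrix with columns, in this order, $c_1,c_2,c_3,d_1,c_4,c_5,d_2,d_3,d_4,d_5,z$. Systems. An $[n,k]_{q^m/q}$ $q$-system is an $n$-dimensional $\mathbb{F}_q$-subspace $U\leq F^k$ with $\langle U\rangle_F=F^k$, $F=\mathbb{F}_{q^m}$. It is $h$-scattered if $\dim_{\mathbb{F}_q}(U\cap H)\leq h$ for every $h$-dimensional $F$-subspace $H\leq F^k$, and then extremal if $n=\lfloor km/(h+1)\rfloor$. Two systems in $F^k$ are equivalent if $U'=A(\sigma(U))$ with $A\in\operatorname{GL}(k,F)$, $\sigma\in\operatorname{Aut}(F)$. Codes. An $[n,r]_{q^m/q}$ code is an $r$-dimensional $F$-subspace $C\leq F^n$. The rank weight of $x\in F^n$ is the $\mathbb{F}_q$-dimension of the span of its coordinates; $d(C)$ is the minimum rank weight of a nonzero word, and $[n,r,d]_{q^m/q}$ means $d(C)=d$. $C^\perp=\{y: xy^\top=0\ \forall x\in C\}$. A code is nondegenerate if the columns of a generator matrix are $\mathbb{F}_q$-independent; the $\mathbb{F}_q$-span of the columns is then a $q$-system, said to be associated with the code. For $n>m$,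 $C$ is quasi-MRD if $m-\lceil mr/n\rceil-d(C)+1=0$. Expanding $x\in F^n$ over an $\mathbb{F}_q$-basis of $F$ as an $m\times n$ matrix, $\operatorname{Rsupp}_q(x)$ is its row space; $\operatorname{Rsupp}_q(V)$ is the sum of supports of an $F$-basis of $V$; $d_i(C)=\min\{\dim_{\mathbb{F}_q}\operatorname{Rsupp}_q(V): V\leq C,\dim_FV=i\}$. Codes $C,C'\leq F^n$ are rank-metric equivalent if $C'=\sigma(C)A$ with $A\in\operatorname{GL}(n,q)$, $\sigma\in\operatorname{Aut}(F)$. A nontrivial direct sum is a code $D_1\oplus D_2$ on two disjoint nonempty coordinate blocks with $D_1,D_2$ both of positive dimension. For integers $s_1,s_2\geq0$, an order-one direct-sum code is $D_{(s_1,s_2)}=D_{s_1}\oplus D_{s_2}$ on disjoint coordinate blocks, where each $D_{s_i}$ is any nondegenerate $[m+s_i,2,m-1]_{q^m/q}$ code. *)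

(* Defs.v *)
From HB Require Import structures.
From mathcomp Require Import all_boot all_order all_algebra all_field.
Set Implicit Arguments.
Unset Strict Implicit.
Unset Printing Implicit Defensive.
Import GRing.Theory Num.Theory.
Local Open Scope ring_scope.

Definition p32 : {poly 'F_2} := 'X^5 + 'X^2 + 1.

Lemma size_p32 : size p32 = 6%N.
Proof.
by rewrite /p32 -addrA size_polyDl ?size_polyXn // size_polyDl ?size_polyXn ?size_poly1.
Qed.

Lemma p32_monic : p32 \is monic.
Proof. by rewrite monicE lead_coefE size_p32 /p32 !coefE. Qed.

Lemma F2P (x : 'F_2) : x = 0 \/ x = 1.
Proof. by case: x => -[|[|//]] ? ; [left|right]; apply: val_inj. Qed.

Lemma p32_no_factor (q r : {poly 'F_2}) :
  p32 = q * r -> (size q <= 3)%N -> (size r <= 5)%N -> False.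
Proof.
move=> e sq sr.
have q3 i : (3 <= i)%N -> q`_i = 0 by move=> h; apply/nth_default/(leq_trans sq).
have r5 i : (5 <= i)%N -> r`_i = 0 by move=> h; apply/nth_default/(leq_trans sr).
have := congr1 (fun p : {poly 'F_2} => [:: p`_0; p`_1; p`_2; p`_3; p`_4; p`_5; p`_6]) e.
rewrite !coefM /p32 !coefE /= !big_ord_recl !big_ord0 /= /bump /=.
rewrite !addSn !add0n !subSS !subn0 => E; move: E.
rewrite ?(q3 3) ?(q3 4) ?(q3 5) ?(q3 6) ?(r5 5) ?(r5 6) //.
case: (F2P q`_0) => ->; case: (F2P q`_1) => ->; case: (F2P q`_2) => ->;
case: (F2P r`_0) => ->; case: (F2P r`_1) => ->; case: (F2P r`_2) => ->;
case: (F2P r`_3) => ->; case: (F2P r`_4) => -> /eqP; vm_compute; done.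
Qed.

Lemma p32_mi : monic_irreducible_poly p32.
Proof.
split; last exact: p32_monic.
split; first by rewrite size_p32.
move=> q sq1 /dvdpP [r e].
have p0 : p32 != 0 by rewrite monic_neq0 // p32_monic.
have [q0 r0] : q != 0 /\ r != 0.
  by move: p0; rewrite e mulf_eq0 negb_or => /andP[].
have sz : (size r + size q = 7)%N.
  have := size_p32; rewrite e size_mul //.
  by case: (size r + size q)%N => // n /= ->.
rewrite -dvdp_size_eqp ?size_p32; last by rewrite e dvdp_mulIr.
have sq0 : (0 < size q)%N by rewrite size_poly_gt0.
have sr0 : (0 < size r)%N by rewrite size_poly_gt0.
apply/eqP; case: (leqP (size q) 3) => h.
  exfalso; apply: (@p32_no_factor q r) => //; first by rewrite mulrC.
  by case: (size q) sq0 sq1 sz h => [|[|[|[|]]]] //= _ _ /eqP;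
    rewrite !addnS addn0 => /eqP [] ->.
case: (leqP (size q) 5) => h5.
  exfalso; apply: (@p32_no_factor r q) => //.
  by rewrite -(leq_add2r (size q)) sz; case: (size q) h => [|[|[|[|]]]].
by case: (size q) (size r) sz h5 sr0 => [|[|[|[|[|[|[|n]]]]]]] [|[|k]] //=;
   rewrite ?addnS //= => -[].
Qed.

Notation F2 := 'F_2.
Notation F32 := {poly %/ p32 with p32_mi}.

Definition omega : F32 := 'qX.

Definition m : nat := 5.

Lemma dim_F32 : \dim {: F32} = m.
Proof. by rewrite dimvf /dim /= mk_monicE ?size_p32 //; exact: p32_mi. Qed.

(* F2-subspaces of F32^k have type [{vspace F32vec k}]: the carrier is
   [{ffun 'I_k -> F32}], which the library equips with its F2-structure,
   whereas ['cV[F32]_k] and ['rV[F32]_k] carry the F32-structure.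
   F32-subspaces of F32^k are row spaces of matrices, vectors being passed
   to rows by [to_row]. *)
Notation F32vec k := {ffun 'I_k -> F32}.

Definition to_row k (u : F32vec k) : 'rV[F32]_k := \row_i u i.

Definition column k n (G : 'M[F32]_(k, n)) (j : 'I_n) : F32vec k :=
  [ffun i => G i j].

Definition columns k n (G : 'M[F32]_(k, n)) : seq (F32vec k) :=
  [seq column G j | j : 'I_n].

Definition column_system k n (G : 'M[F32]_(k, n)) :
  {vspace F32vec k} := <<columns G>>%VS.

Definition F32_span k (U : {vspace F32vec k}) : 'M[F32]_k :=
  (\sum_(u : F32vec k | u \in U) <<to_row u>>)%MS.

(* An F32-subspace viewed as an F2-subspace; the spanning family is the whole
   (F2-closed) set of its vectors. *)
Definition F2_restrict k (H : 'M[F32]_k) : {vspace F32vec k} :=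
  <<[seq u <- enum (F32vec k) | (to_row u <= H)%MS]>>%VS.

Lemma mem_F2_restrict k (H : 'M[F32]_k) u :
  (u \in F2_restrict H) = (to_row u <= H)%MS.
Proof.
rewrite /F2_restrict; set s := [seq _ <- _ | _].
apply/idP/idP => [us | uH]; last first.
  by apply: memv_span; rewrite mem_filter; apply/andP; split; last exact: mem_enum.
rewrite (@coord_span _ _ _ (in_tuple s) _ us).
have -> (c : 'I_(size s) -> F2) :
   to_row (\sum_i c i *: (in_tuple s)`_i) =
   \sum_i (c i)%:A *: to_row (in_tuple s)`_i.
  apply/rowP => j; rewrite mxE sum_ffunE summxE; apply: eq_bigr => i _.
  by rewrite !mxE ffunE mulr_algl.
apply: summx_sub => i _; apply: scalemx_sub.
have : s`_i \in s by rewrite mem_nth.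
by rewrite mem_filter => /andP[].
Qed.

Definition is_system (n k : nat) (U : {vspace F32vec k}) : Prop :=
  \dim U = n /\ row_full (F32_span U).

Definition scattered (h k : nat) (U : {vspace F32vec k}) : Prop :=
  forall H : 'M[F32]_k, \rank H = h ->
    (\dim (U :&: F2_restrict H) <= h)%N.

Definition extremal_scattered (h n k : nat) (U : {vspace F32vec k}) : Prop :=
  [/\ is_system n U, scattered h U & n = ((k * m) %/ h.+1)%N].

(* The semilinear map u |-> A sigma(u), with u seen as a column. *)
Definition semilinear_act k (A : 'M[F32]_k) (sigma : F32 -> F32)
  (u : F32vec k) : F32vec k :=
  [ffun i => \sum_j A i j * sigma (u j)].

Definition system_equiv k (U U' : {vspace F32vec k}) : Prop :=
  exists (A : 'M[F32]_k) (sigma : {rmorphism F32 -> F32}),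
    [/\ A \in unitmx, bijective sigma &
        forall v, v \in U' <-> exists2 u, u \in U & v = semilinear_act A sigma u].

(* A code in F32^n is the row space of a matrix C : 'M[F32]_(r, n). *)

Definition dual_code r n (C : 'M[F32]_(r, n)) : 'M[F32]_n := kermx C^T.

Definition rank_weight n (x : 'rV[F32]_n) : nat :=
  \dim <<[seq x ord0 j | j : 'I_n]>>%VS.

(* The default n of the minimum is an upper bound for all rank weights, hence
   is only relevant for the zero code. *)
Definition min_dist r n (C : 'M[F32]_(r, n)) : nat :=
  \big[minn/n]_(x : 'rV[F32]_n | (x <= C)%MS && (x != 0)) rank_weight x.

Definition is_code (n r d s : nat) (C : 'M[F32]_(s, n)) : Prop :=
  \rank C = r /\ min_dist C = d.

Definition generator_matrix k n s (G : 'M[F32]_(k, n)) (C : 'M[F32]_(s, n)) :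
  Prop := row_free G /\ (G :=: C)%MS.

Definition nondegenerate_code s n (C : 'M[F32]_(s, n)) : Prop :=
  exists2 G : 'M[F32]_(\rank C, n), generator_matrix G C & free (columns G).

Definition associated_system k s n (C : 'M[F32]_(s, n))
  (U : {vspace F32vec k}) : Prop :=
  exists G : 'M[F32]_(k, n),
    [/\ generator_matrix G C, free (columns G) & U = column_system G].

Definition quasi_MRD s n (C : 'M[F32]_(s, n)) : Prop :=
  (m < n)%N /\
  m%:Z - Num.ceil ((m * \rank C)%:R / n%:R : rat) - (min_dist C)%:Z + 1 = 0.

Definition expand n (x : 'rV[F32]_n) : 'M[F2]_(\dim {: F32}, n) :=
  \matrix_(i, j) coord (vbasis {: F32}) i (x 0 j).

Definition Rsupp s n (V : 'M[F32]_(s, n)) : 'M[F2]_n :=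
  (\sum_(i < \rank V) <<expand (row i (row_base V))>>)%MS.

(* d_i(C); subspaces V range over square matrices, and the default n of the
   minimum bounds all support dimensions, so it is only relevant when i exceeds
   the dimension of C. *)
Definition gen_weight s n (C : 'M[F32]_(s, n)) (i : nat) : nat :=
  \big[minn/n]_(V : 'M[F32]_n | (V <= C)%MS && (\rank V == i)) \rank (Rsupp V).

Definition code_equiv r s n (C : 'M[F32]_(r, n)) (C' : 'M[F32]_(s, n)) : Prop :=
  exists (A : 'M[F2]_n) (sigma : {rmorphism F32 -> F32}),
    [/\ A \in unitmx, bijective sigma &
        (C' :=: map_mx sigma C *m map_mx (in_alg F32) A)%MS].

(* D = D1 (+) D2, the coordinates 'I_n being split by the bijection f into two
   disjoint blocks of lengths n1 and n2. *)
Definition direct_sum s n (D : 'M[F32]_(s, n)) n1 n2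
  (f : 'I_n1 + 'I_n2 -> 'I_n) (D1 : 'M[F32]_n1) (D2 : 'M[F32]_n2) : Prop :=
  bijective f /\
  forall x : 'rV[F32]_n,
    (x <= D)%MS = (colsub (f \o inl) x <= D1)%MS && (colsub (f \o inr) x <= D2)%MS.

Definition nontrivial_direct_sum s n (D : 'M[F32]_(s, n)) : Prop :=
  exists n1 n2 (f : 'I_n1 + 'I_n2 -> 'I_n) (D1 : 'M[F32]_n1) (D2 : 'M[F32]_n2),
    [/\ (0 < n1)%N, (0 < n2)%N, (0 < \rank D1)%N, (0 < \rank D2)%N &
        direct_sum D f D1 D2].

Definition order_one_direct_sum s1 s2 s n (D : 'M[F32]_(s, n)) : Prop :=
  exists (f : 'I_(m + s1) + 'I_(m + s2) -> 'I_n)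
         (D1 : 'M[F32]_(m + s1)) (D2 : 'M[F32]_(m + s2)),
    [/\ nondegenerate_code D1, is_code 2 m.-1 D1, nondegenerate_code D2,
        is_code 2 m.-1 D2 & direct_sum D f D1 D2].

Definition Rmat : 'M[F32]_(7, 4) :=
  let w := omega in
  \matrix_(i, j) nth 0 (nth [::]
    [:: [:: w^+4 + w^+2;             w^+2 + w + 1;          w^+4 + w^+2 + w;         0];
        [:: w^+4;                    w^+4 + w^+3 + 1;       w^+4 + w^+3 + w^+2 + w;  0];
        [:: w^+3 + w;                w^+2;                  w^+4 + w;                w];
        [:: w^+3 + w;                w^+3 + w^+2 + w + 1;   w^+2 + 1;                w^+2];
        [:: w^+4 + w^+3 + w + 1;     w^+4;                  w^+4 + w^+2 + 1;         w^+3];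
        [:: w^+4 + w + 1;            w^+4;                  w^+4 + w^+2 + w + 1;     w^+4];
        [:: w^+4 + 1;                w^+4;                  w^+2 + 1;                0]] i) j.

Definition Gmat : 'M[F32]_(7, 11) := row_mx Rmat (1%:M : 'M_7).

Definition xi (i : nat) : F32 := omega ^+ i.-1.
Definition c_col (i : nat) : seq F32 := [:: xi i; 0; xi i ^+ 2; xi i ^+ 4].
Definition d_col (i : nat) : seq F32 :=
  [:: 0; xi i; xi i ^+ 4; xi i ^+ 2 + xi i ^+ 4].
Definition z_col : seq F32 := [:: 0; 0; 1; 0].

Definition HBmat : 'M[F32]_(4, 11) :=
  \matrix_(i, j) nth 0 (nth [::]
    [:: c_col 1; c_col 2; c_col 3; d_col 1; c_col 4; c_col 5;
        d_col 2; d_col 3; d_col 4; d_col 5; z_col] j) i.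

(* Main.v *)
Require Import Defs.
From HB Require Import structures.
From mathcomp Require Import all_boot all_order all_algebra all_field.
From mathcomp Require Import ring zify.
Set Implicit Arguments.
Unset Strict Implicit.
Unset Printing Implicit Defensive.
Import GRing.Theory Num.Theory.
Local Open Scope ring_scope.

(** The word u *m HBmat, u = (a, b, c, d), lists the values at 1, omega, ...,
omega^4 of the two linearized polynomials
  f(x) = a x + c x^2 + d x^4  and  g(y) = b y + d y^2 + (c + d) y^4,
followed by the scalar c.  All that the theorem says about D is read off from
the degrees of f and g, not from an enumeration of subcodes.

An r-dimensional F2-space of coordinates supports a subcode V when V = Y B with
B an r-row matrix over F2.  The entrywise Frobenius conjugates of V then satisfy
V^(k) = Y^(k) B, so that K of them span at most r dimensions: if V has s rows
and K s > r, some nontrivial combination of the conjugates vanishes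
(conjugate_dependency).  The coordinates of such a combination are the values at
1, ..., omega^4 of two linearized polynomials, of degree less than 32 once x^32 is
replaced by x.  As they vanish on a basis, all their coefficients are zero
(linearized_eq0), which gives eleven linear equations (frob_relations).
 - For K = 3 the equations force the subcode to contain the words of (1,0,0,0)
   and (0,1,0,0), and these two need a support of dimension 10.  Hence a
   support of an s-dimensional subcode has dimension at least min(10, 3 s)
   (support_lower_bound): this gives d_2 >= 6 and d_3 >= 9.
 - For s = 1 and K = 4 a word of rank 3 would give c^2 (c + d) = d^3, which is
   impossible since t^3 = t^2 + 1 has no root in F32 (word_lower_bound): this
   gives d_1 >= 4.
The upper bounds and the equality of D with the row space of HBmat are finite
verifications on explicit matrices.

A plane meeting the column system of G in three independent vectors gives a word
of rank at most 3 in D, so the system is 2-scattered because d_1 >= 4.  Dually, a word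
of rank 1 in C is an F2-dependency between the columns of HBmat, so d(C) >= 2.
Lower bounds on supports are invariant under equivalence
(weight_bound_transport).  An order-one direct sum has a block of length 5
carrying a 2-dimensional subcode, against d_2 = 6; and for a nontrivial direct sum
of total dimension 4 the bounds 4, 6, 9 applied to both blocks require more than
11 coordinates. *)

(** * The field F32 and its Frobenius powers *)

Lemma pchar_F32 : 2 \in [pchar F32].
Proof. by rewrite (pchar_lalg F32) pchar_Fp. Qed.

Lemma F32_expr32 (x : F32) : x ^+ 32 = x.
Proof.
rewrite -[RHS]expf_card; congr (_ ^+ _).
by rewrite card_monic_qpoly ?size_p32 ?p32_monic // card_Fp.
Qed.

Lemma omega5 : omega ^+ 5 = omega ^+ 2 + 1.
Proof.
have: in_qpoly p32 p32 = 0 :> F32.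
  apply: val_inj; rewrite /= /mk_monic size_p32 p32_monic /=.
  exact: Pdiv.RingMonic.rmodpp p32_monic.
rewrite [X in in_qpoly _ X]/p32 !rmorphD !rmorphXn rmorph1 /= -addrA => /eqP.
by rewrite addr_eq0 (oppr_pchar2 pchar_F32) => /eqP.
Qed.

Lemma addbb_F32 (x : F32) : x + x = 0.
Proof. exact: addrr_pchar2 pchar_F32 x. Qed.

Lemma addr_eq0_F32 (x y : F32) : x + y = 0 -> x = y.
Proof. by move/eqP; rewrite addr_eq0 (oppr_pchar2 pchar_F32) => /eqP. Qed.

Lemma natr_addb (a b : bool) : (a (+) b)%:R = a%:R + b%:R :> F32.
Proof. by case: a b => [] [] /=; rewrite ?addr0 ?add0r // addbb_F32. Qed.

(** The powers of the Frobenius automorphism, as bundled morphisms, so that they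
can be mapped over matrices. *)
Definition frob (k : nat) (x : F32) : F32 := x ^+ (2 ^ k).

Fact frob_zmod k : zmod_morphism (frob k).
Proof.
move=> x y; rewrite /frob; elim: k => [|k IH]; first by rewrite !expr1.
by rewrite expnSr !exprM IH -!(pFrobenius_autE pchar_F32) rmorphB.
Qed.

Fact frob_monoid k : monoid_morphism (frob k).
Proof. by split=> [|x y]; rewrite /frob ?expr1n ?exprMn. Qed.

HB.instance Definition _ k :=
  GRing.isZmodMorphism.Build F32 F32 (frob k) (frob_zmod k).
HB.instance Definition _ k :=
  GRing.isMonoidMorphism.Build F32 F32 (frob k) (frob_monoid k).

Lemma frobD j k x : frob j (frob k x) = frob (k + j) x.
Proof. by rewrite /frob -exprM expnD. Qed.

Lemma frob_add5 k x : frob (5 + k) x = frob k x.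
Proof. by rewrite /frob expnD exprM F32_expr32. Qed.

Lemma frob_sqr k x : frob k (x ^+ 2) = frob k.+1 x.
Proof. by rewrite /frob -exprM expnS. Qed.

Lemma frob_quartic k x : frob k (x ^+ 4) = frob k.+2 x.
Proof. by rewrite /frob -exprM !expnS mulnA. Qed.

(** * Supports of codes *)

(** Supports are handled through their generators: V is supported on the row space
of a matrix B over F2 when (V <= in_F32 B)%MS over F32.  This relation is
compatible with products, with maps by field automorphisms and with passing to
subcodes; sub_Rsupp and Rsupp_sub say that Rsupp V is the smallest such space. *)
Local Notation in_F32 B := (map_mx (in_alg F32) B).

(** Field automorphisms fix the prime field. *)
Lemma map_in_F32 (f : {rmorphism F32 -> F32}) r n (B : 'M[F2]_(r, n)) :
  map_mx f (in_F32 B) = in_F32 B.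
Proof.
apply/matrixP => i j; rewrite !mxE.
by case: (F2P (B i j)) => ->; rewrite ?rmorph0 ?rmorph1.
Qed.

Lemma mulr_in_F32 (y : F32) (b : F2) : y * in_alg F32 b = b *: y.
Proof. by rewrite in_algE mulr_algr. Qed.

Lemma expandK n (x : 'rV[F32]_n) :
  x = (\row_k (vbasis {: F32})`_k) *m in_F32 (expand x).
Proof.
apply/rowP => j; rewrite [LHS](coord_vbasis (memvf (x 0 j))) mxE.
by apply: eq_bigr => k _; rewrite !mxE mulr_in_F32.
Qed.

Lemma sub_Rsupp s n (V : 'M[F32]_(s, n)) : (V <= in_F32 (Rsupp V))%MS.
Proof.
have : (V <= row_base V)%MS by rewrite eq_row_base.
move/submx_trans; apply; apply/row_subP => i.
rewrite [row i _]expandK mulmx_sub // map_submx.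
by apply: (sumsmx_sup i) => //; rewrite genmxE.
Qed.

Lemma Rsupp_sub s n r (V : 'M[F32]_(s, n)) (B : 'M[F2]_(r, n)) :
  (V <= in_F32 B)%MS -> (Rsupp V <= B)%MS.
Proof.
move=> VB; apply/sumsmx_subP => i _; rewrite genmxE.
have /submxP[y ->] : (row i (row_base V) <= in_F32 B)%MS.
  by rewrite (submx_trans (row_sub _ _)) // eq_row_base.
have -> : expand (y *m in_F32 B) =
    (\matrix_(a, k) coord (vbasis {: F32}) a (y 0 k)) *m B.
  apply/matrixP => a j; rewrite !mxE linear_sum; apply: eq_bigr => k _.
  by rewrite !mxE mulr_in_F32 linearZ /= mulrC.
exact: submxMl.
Qed.

Lemma bigminn_eq (T : finType) (P : pred T) (f : T -> nat) n d :
    (d <= n)%N -> (forall x, P x -> (d <= f x)%N) ->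
    (exists2 x, P x & (f x <= d)%N) ->
  \big[minn/n]_(x | P x) f x = d.
Proof.
move=> dn lb [x0 Px0 ub]; apply/eqP; rewrite eqn_leq; apply/andP; split.
  apply: leq_trans ub; rewrite -big_filter.
  have : x0 \in [seq x <- index_enum T | P x] by rewrite mem_filter Px0 mem_index_enum.
  elim: [seq _ <- _ | _] => // a l IH; rewrite inE big_cons geq_min.
  by case/orP => [/eqP <-|/IH ->]; rewrite ?leqnn ?orbT.
by elim/big_ind: _ => // a b; rewrite leq_min => -> ->.
Qed.

(** Reduces a generalized weight to a lower bound on all supports of subcodes and
one witness V, which may have any number of rows. *)
Lemma gen_weight_eq (s n i d t b : nat) (C : 'M[F32]_(s, n)) (V : 'M[F32]_(t, n))
    (B : 'M[F2]_(b, n)) :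
    (forall (W : 'M[F32]_n) r (A : 'M[F2]_(r, n)), (W <= C)%MS -> \rank W = i ->
       (W <= in_F32 A)%MS -> (d <= r)%N) ->
    (V <= C)%MS -> \rank V = i -> (V <= in_F32 B)%MS -> (\rank B <= d)%N ->
  gen_weight C i = d.
Proof.
move=> lb VC rV VB rB.
have lb' (W : 'M[F32]_n) : (W <= C)%MS -> \rank W = i -> (d <= \rank (Rsupp W))%N.
  move=> WC rW; apply: lb WC rW _ => //; last first.
    apply: submx_trans (sub_Rsupp W) _.
    by rewrite map_submx -(eq_row_base (Rsupp W)).
apply: bigminn_eq.
- have := lb' <<V>>%MS; rewrite !genmxE VC => /(_ isT rV) h.
  by apply: leq_trans h (rank_leq_row _).
- by move=> W /andP[WC /eqP rW]; apply: lb'.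
exists <<V>>%MS; first by rewrite !genmxE VC rV eqxx.
by apply: leq_trans rB; apply/mxrankS/Rsupp_sub; rewrite genmxE.
Qed.

Lemma rank_weight_sub n r (x : 'rV[F32]_n) (B : 'M[F2]_(r, n)) :
  (x <= in_F32 B)%MS -> (rank_weight x <= r)%N.
Proof.
case/submxP => y ->.
have sub : (<<[seq (y *m in_F32 B)%R ord0 j | j : 'I_n]>> <=
             <<[seq y ord0 k | k : 'I_r]>>)%VS.
  apply/span_subvP => _ /mapP[j _ ->]; rewrite !mxE memv_suml // => k _.
  rewrite !mxE mulr_in_F32 memvZ // memv_span //.
  by apply/mapP; exists k => //; rewrite mem_enum.
rewrite /rank_weight (leq_trans (dimvS sub)) // (leq_trans (dim_span _)) //.
by rewrite size_map -cardE card_ord.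
Qed.

(** With rank_weight_sub: the rank weight of a word is the least dimension of a
space of supports containing it.  The rows of B hold the coordinates of the
entries of x in a basis of their span. *)
Lemma sub_rank_weight n (x : 'rV[F32]_n) :
  exists B : 'M[F2]_(rank_weight x, n), (x <= in_F32 B)%MS.
Proof.
set Q := <<[seq x ord0 j | j : 'I_n]>>%VS.
exists (\matrix_(k, j) coord (vbasis Q) k (x 0 j)).
apply/submxP; exists (\row_k (vbasis Q)`_k); apply/rowP => j; rewrite !mxE.
have xQ : x 0 j \in Q by apply/memv_span/mapP; exists j; rewrite ?mem_enum.
rewrite {1}(coord_vbasis xQ); apply: eq_bigr => k _.
by rewrite !mxE mulr_in_F32.
Qed.

Lemma min_dist_eq s n d (C : 'M[F32]_(s, n)) (x : 'rV[F32]_n) (B : 'M[F2]_(d, n)) :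
    (forall (y : 'rV[F32]_n) r (A : 'M[F2]_(r, n)), (y <= C)%MS -> y != 0 ->
       (y <= in_F32 A)%MS -> (d <= r)%N) ->
    (x <= C)%MS -> x != 0 -> (x <= in_F32 B)%MS ->
  min_dist C = d.
Proof.
move=> lb xC x0 xB; apply: bigminn_eq.
- have := lb _ _ 1%:M xC x0; rewrite map_mx1; apply; exact: submx1.
- by move=> y /andP[yC y0]; have [A yA] := sub_rank_weight y; apply: lb yA.
by exists x; rewrite ?xC //; apply: rank_weight_sub xB.
Qed.

(** A dependency between the columns of G over F2 is a vector over F2 that is
orthogonal to all rows, so this property depends on the row space only. *)
Lemma free_columnsP k n (G : 'M[F32]_(k, n)) :
  reflect (forall w : 'rV[F2]_n, in_F32 w *m G^T = 0 -> w = 0) (free (columns G)).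
Proof.
have sumE (c : 'I_n -> F2) i :
    (\sum_j c j *: column G j) i = (in_F32 (\row_j c j) *m G^T) 0 i.
  rewrite sum_ffunE !mxE; apply: eq_bigr => j _.
  by rewrite !ffunE !mxE mulrC mulr_in_F32.
have -> : free (columns G) = free (map_tuple (column G) (ord_tuple n)) by [].
have nthE (c : 'I_n -> F2) :
    \sum_j c j *: (map_tuple (column G) (ord_tuple n))`_j = \sum_j c j *: column G j.
  by apply: eq_bigr => j _; rewrite -tnth_nth tnth_map tnth_ord_tuple.
apply: (iffP freeP) => [fr w Gw|fr c].
  apply/rowP => j; rewrite mxE; apply: fr; rewrite nthE; apply/ffunP => i.
  rewrite sumE ffunE; have -> : \row_j w 0 j = w by apply/rowP => a; rewrite mxE.
  by rewrite Gw mxE.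
rewrite nthE => Gc j; have /rowP/(_ j) : \row_j c j = 0; last by rewrite !mxE.
by apply: fr; apply/rowP => i; rewrite -sumE Gc ffunE mxE.
Qed.

(** * Dependencies between Frobenius conjugates *)

(** The K conjugates of Y have K s rows in a space of dimension r. *)
Lemma frob_dependency s r K (Y : 'M[F32]_(s, r)) :
    (r < K * s)%N ->
  exists u : nat -> 'rV[F32]_s,
    [/\ exists2 k, (k < K)%N & u k != 0, forall k, (K <= k)%N -> u k = 0 &
        \sum_(k < K) u k *m map_mx (frob k) Y = 0].
Proof.
move=> rK; pose A := \mxcol_(k < K) map_mx (frob k) Y.
have : kermx A != 0.
  rewrite -mxrank_eq0 mxrank_ker -lt0n subn_gt0.
  apply: leq_ltn_trans (rank_leq_col _) _.
  by rewrite sum_nat_const card_ord.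
case/rowV0Pn => v /sub_kermxP vA v0.
exists (fun k => if insub k is Some k' then submxrow v k' else 0); split.
- case: (pickP (fun k : 'I_K => submxrow v k != 0)) => [k vk|v_0].
    by exists k => //; rewrite valK.
  case/negP: v0; rewrite -(submxrowK v) -(mxrow0 _) eq_sym.
  by apply/eqP/eq_mxrow => k; apply/esym/eqP/negbFE/v_0.
- by move=> k Kk; rewrite insubF // ltnNge Kk.
rewrite -[RHS]vA -[in RHS](submxrowK v) mul_mxrow_mxcol.
by apply: eq_bigr => k _; rewrite valK.
Qed.

(** The order of omega divides the prime 31. *)
Lemma omega_prim : 31.-primitive_root omega.
Proof.
have w0 : omega != 0.
  apply/eqP => w0; have := omega5; rewrite w0 !expr0n add0r => /eqP.
  by rewrite eq_sym oner_eq0.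
have w31 : omega ^+ 31 = 1 by apply: (mulfI w0); rewrite -exprS F32_expr32 mulr1.
have [m prim m31] := prim_order_exists (isT : 0 < 31)%N w31.
case/primeP: (isT : prime 31) => _ /(_ m m31) /orP[] /eqP m_eq; last first.
  by rewrite -[X in X.-primitive_root _]m_eq.
move: prim; rewrite m_eq => /prim_expr_order; rewrite expr1 => w1.
have := omega5; rewrite w1 !expr1n.
by rewrite addbb_F32 => /eqP; rewrite oner_eq0.
Qed.

(** The conjugates omega^(2^j), j < 5, are pairwise distinct. *)
Lemma vandermonde5_unit :
  Vandermonde 5 (\row_(j < 5) frob j omega) \in unitmx.
Proof.
rewrite unitmxE unitfE det_Vandermonde.
apply/prodf_neq0 => i _; apply/prodf_neq0 => j ij.
rewrite !mxE subr_eq0 (eq_prim_root_expr omega_prim).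
by case: i j ij => [[|[|[|[|[|i]]]]] Hi] [[|[|[|[|[|j]]]]] Hj].
Qed.

(** A linearized polynomial of degree less than 32 that vanishes on a basis of F32
over F2 is zero; on the basis of powers of omega its coefficients are the
solution of a Vandermonde system. *)
Lemma linearized_eq0 (e : nat -> F32) :
  (forall i, (i < 5)%N -> \sum_(j < 5) e j * frob j (omega ^+ i) = 0) ->
  forall j, (j < 5)%N -> e j = 0.
Proof.
move=> He j j5; set V := Vandermonde 5 (\row_(j < 5) frob j omega).
have Ve : V *m (\col_(j < 5) e j) = 0.
  apply/colP => i; rewrite !mxE -[RHS](He i (ltn_ord i)).
  by apply: eq_bigr => k _; rewrite !mxE rmorphXn mulrC.
have /colP/(_ (Ordinal j5)) : \col_(j < 5) e j = 0.
  by rewrite -[LHS](mulKmx vandermonde5_unit) Ve mulmx0.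
by rewrite !mxE.
Qed.

Definition row4 (a b c d : F32) : 'rV[F32]_4 := \row_j nth 0 [:: a; b; c; d] j.

Lemma row4_eta (u : 'rV[F32]_4) :
  u = row4 (u 0 (inord 0%N)) (u 0 (inord 1%N)) (u 0 (inord 2%N)) (u 0 (inord 3%N)).
Proof.
apply/rowP => j; rewrite mxE -[in LHS](inord_val j).
by case: j => [[|[|[|[|j]]]] Hj].
Qed.

Definition word_entry k (a c d x : F32) :=
  a * frob k x + c * frob k.+1 x + d * frob k.+2 x.

(** In the order of the columns of HBmat, the conjugated word takes the values of
the conjugates of f on the xi's in the c-columns, of g in the d-columns, and
has the coordinate c in the column z. *)
Lemma row4_frobH k a b c d :
  row4 a b c d *m map_mx (frob k) HBmat =
  \row_j nth 0 [:: word_entry k a c d (xi 1); word_entry k a c d (xi 2);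
    word_entry k a c d (xi 3); word_entry k b d (c + d) (xi 1);
    word_entry k a c d (xi 4); word_entry k a c d (xi 5);
    word_entry k b d (c + d) (xi 2); word_entry k b d (c + d) (xi 3);
    word_entry k b d (c + d) (xi 4); word_entry k b d (c + d) (xi 5); c] j.
Proof.
apply/rowP => j; rewrite !mxE !big_ord_recl big_ord0 !mxE /=.
case: j => [[|[|[|[|[|[|[|[|[|[|[|j]]]]]]]]]]] Hj] //=;
  move: (xi 1) (xi 2) (xi 3) (xi 4) (xi 5) => x1 x2 x3 x4 x5;
  rewrite /word_entry ?rmorphD ?rmorph0 ?rmorph1 /= ?frob_sqr ?frob_quartic; ring.
Qed.

(** Comparison of coefficients: x^(2^j) gets a_j from the j-th conjugate, c_(j-1)
from the previous one and d_(j-2) from the one before, indices being taken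
modulo 5 because x^32 = x.  The same holds for g with (b, d, c + d), and the last
column contributes the sum of the c_k. *)
Lemma frob_relations (a b c d : nat -> F32) :
    \sum_(k < 5) row4 (a k) (b k) (c k) (d k) *m map_mx (frob k) HBmat = 0 ->
  [/\ [/\ a 0%N + c 4%N + d 3%N = 0, a 1%N + c 0%N + d 4%N = 0,
          a 2%N + c 1%N + d 0%N = 0, a 3%N + c 2%N + d 1%N = 0 &
          a 4%N + c 3%N + d 2%N = 0],
      [/\ b 0%N + d 4%N + (c 3%N + d 3%N) = 0, b 1%N + d 0%N + (c 4%N + d 4%N) = 0,
          b 2%N + d 1%N + (c 0%N + d 0%N) = 0, b 3%N + d 2%N + (c 1%N + d 1%N) = 0 &
          b 4%N + d 3%N + (c 2%N + d 2%N) = 0] &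
      c 0%N + c 1%N + c 2%N + c 3%N + c 4%N = 0].
Proof.
under eq_bigr do rewrite row4_frobH.
move/rowP => E.
have wrap (p q r : nat -> F32) :
   (forall i, (i < 5)%N ->
      \sum_(k < 5) word_entry k (p k) (q k) (r k) (omega ^+ i) = 0) ->
   [/\ p 0%N + q 4%N + r 3%N = 0, p 1%N + q 0%N + r 4%N = 0, p 2%N + q 1%N + r 0%N = 0,
       p 3%N + q 2%N + r 1%N = 0 & p 4%N + q 3%N + r 2%N = 0].
  move=> h.
  pose e := [:: p 0%N + q 4%N + r 3%N; p 1%N + q 0%N + r 4%N; p 2%N + q 1%N + r 0%N;
                p 3%N + q 2%N + r 1%N; p 4%N + q 3%N + r 2%N].
  have e0 : forall j, (j < 5)%N -> e`_j = 0.
    apply: linearized_eq0 => i i5; rewrite -[RHS](h i i5).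
    rewrite !big_ord_recl !big_ord0 /= /bump /= /word_entry.
    rewrite -(frob_add5 0 (omega ^+ i)) -(frob_add5 1 (omega ^+ i)) /=.
    ring.
  by split; [have := e0 0|have := e0 1|have := e0 2|have := e0 3|have := e0 4]; apply.
have E' j (j11 : (j < 11)%N) := E (Ordinal j11).
split.
- apply: wrap => i i5.
  have h11 : (nth 0 [:: 0; 1; 2; 4; 5] i < 11)%N.
    by case: i i5 => [|[|[|[|[|i]]]]].
  have := E' _ h11; rewrite summxE mxE => h; rewrite -[RHS]h.
  apply: eq_bigr => k _; rewrite mxE.
  by case: i i5 h11 {h} => [|[|[|[|[|i]]]]].
- apply: (wrap b d (fun k => c k + d k)) => i i5.
  have h11 : (nth 0 [:: 3; 6; 7; 8; 9] i < 11)%N.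
    by case: i i5 => [|[|[|[|[|i]]]]].
  have := E' _ h11; rewrite summxE mxE => h; rewrite -[RHS]h.
  apply: eq_bigr => k _; rewrite mxE.
  by case: i i5 h11 {h} => [|[|[|[|[|i]]]]].
have := E ord_max; rewrite summxE !big_ord_recl big_ord0 !mxE /= => h.
by rewrite -[RHS]h; ring.
Qed.

(** * Lower bounds for the supports of subcodes *)

(** Conjugation leaves B unchanged, so that the conjugates of P *m HBmat satisfy
the dependencies between those of its left factor Y. *)
Lemma conjugate_dependency s r K (P : 'M[F32]_(s, 4)) (B : 'M[F2]_(r, 11)) :
    (P *m HBmat <= in_F32 B)%MS -> (r < K * s)%N -> (K <= 5)%N ->
  exists u : nat -> 'rV[F32]_s,
    [/\ exists2 k, (k < K)%N & u k != 0, forall k, (K <= k)%N -> u k = 0 &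
        \sum_(k < 5) u k *m map_mx (frob k) P *m map_mx (frob k) HBmat = 0].
Proof.
case/submxP => Y PHY rK K5; have [u [u0 uK uY]] := frob_dependency Y rK.
exists u; split=> //.
transitivity (\sum_(k < 5) (u k *m map_mx (frob k) Y) *m in_F32 B).
  apply: eq_bigr => k _.
  by rewrite -!mulmxA -!map_mxM PHY map_mxM map_in_F32.
rewrite -mulmx_suml -(big_mkord predT (fun k => u k *m map_mx (frob k) Y)).
rewrite (big_cat_nat_idem _ _ K5) //=; last exact: addr0.
rewrite big_mkord uY add0r big_nat big1 ?mul0mx // => k /andP[Kk _].
by rewrite uK ?mul0mx.
Qed.

Lemma frob_eq0 k x : (frob k x == 0) = (x == 0).
Proof. exact: fmorph_eq0. Qed.

Lemma map_frob_row4 k a b c d :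
  map_mx (frob k) (row4 a b c d) = row4 (frob k a) (frob k b) (frob k c) (frob k d).
Proof. by apply/rowP => -[[|[|[|[|j]]]] Hj]; rewrite !mxE. Qed.

(** With v_k = u_k P^(k) and v_3 = v_4 = 0 the relations leave only one parameter d:
v_0 = (0, 0, 0, d), v_1 = (0, d, 0, 0) and v_2 = (d, d, 0, 0).  As v_k lies in the
row space of P^(k), undoing the conjugation puts (0, 1, 0, 0) and (1, 1, 0, 0) into
the row space of P. *)
Lemma three_conjugates s (P : 'M[F32]_(s, 4)) (u : nat -> 'rV[F32]_s) :
    row_free P -> (exists2 k, (k < 3)%N & u k != 0) ->
    (forall k, (3 <= k)%N -> u k = 0) ->
    \sum_(k < 5) u k *m map_mx (frob k) P *m map_mx (frob k) HBmat = 0 ->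
  (row4 1 0 0 0 <= P)%MS /\ (row4 0 1 0 0 <= P)%MS.
Proof.
move=> Pfree [k k3 uk] u3.
pose v k := u k *m map_mx (frob k) P.
have v3 k' : (3 <= k')%N -> v k' = 0 by move=> /u3 uk0; rewrite /v uk0 mul0mx.
have [co vE co3] : exists2 co : nat -> nat -> F32,
    forall k', v k' = row4 (co 0%N k') (co 1%N k') (co 2%N k') (co 3%N k') &
    forall i k', (3 <= k')%N -> co i k' = 0.
  exists (fun i k' => v k' 0 (inord i)) => [k'|i k' /v3 ->]; last by rewrite mxE.
  exact: row4_eta.
under eq_bigr do rewrite -/(v _) vE.
case/frob_relations.
rewrite !(co3 _ 3%N) // !(co3 _ 4%N) // !(addr0, add0r).
case=> a0 a1 a2 a3 d2 [b0 b1 b2 b3 c2d2] c012.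
have c2 : co 2%N 2%N = 0 by rewrite d2 addr0 in c2d2.
have d1 : co 3%N 1%N = 0 by rewrite c2 add0r in a3.
have c1 : co 2%N 1%N = 0 by rewrite d2 d1 addr0 add0r in b3.
have c0 : co 2%N 0%N = 0 by rewrite c1 c2 !addr0 in c012.
set d := co 3%N 0%N in a2 b1 b2 *.
have v0E : v 0%N = row4 0 0 0 d by rewrite vE a0 b0 c0.
have v1E : v 1%N = row4 0 d 0 0.
  by rewrite c0 addr0 in a1; rewrite vE a1 (addr_eq0_F32 b1) c1 d1.
have v2E : v 2%N = row4 d d 0 0.
  rewrite c1 addr0 in a2; rewrite d1 c0 addr0 add0r in b2.
  by rewrite vE (addr_eq0_F32 a2) (addr_eq0_F32 b2) c2 d2.
(* Otherwise all v_k vanish, although P is row free and some u_k is nonzero. *)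
have d0 : d != 0.
  apply: contraNneq uk => d0.
  have : v k = 0.
    have row40 : row4 0 0 0 0 = 0 by apply/rowP => -[[|[|[|[|j]]]] Hj]; rewrite !mxE.
    by case: k k3 => [|[|[|k]]] // _; rewrite (v0E, v1E, v2E) d0.
  by move/eqP; rewrite /v mulmx_free_eq0 // row_free_map.
have inP j k' a b : (j + k' = 5)%N -> v k' = row4 a b 0 0 ->
    (row4 (frob j a) (frob j b) 0 0 <= P)%MS.
  move=> jk vk; have := congr1 (map_mx (frob j)) vk.
  rewrite map_frob_row4 !rmorph0 => <-; rewrite /v map_mxM -map_mx_comp /=.
  have -> : map_mx (frob j \o frob k') P = P.
    by apply/matrixP => x y; rewrite mxE /= frobD addnC jk -[5%N]addn0 frob_add5.
  exact: submxMl.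
have row4Z e a b : e *: row4 a b 0 0 = row4 (e * a) (e * b) 0 0.
  by apply/rowP => -[[|[|[|[|j]]]] Hj]; rewrite !mxE /= ?mulr0.
have e2 : (row4 0 1 0 0 <= P)%MS.
  have := inP 4%N 1%N _ _ erefl v1E; rewrite rmorph0.
  move/(scalemx_sub (frob 4 d)^-1); rewrite row4Z mulr0 mulVf //.
  by rewrite frob_eq0.
split=> //.
have := inP 3%N 2%N _ _ erefl v2E.
move/(scalemx_sub (frob 3 d)^-1); rewrite row4Z mulVf ?frob_eq0 // => e12.
have -> : row4 1 0 0 0 = row4 1 1 0 0 - row4 0 1 0 0.
  by apply/rowP => -[[|[|[|[|j]]]] Hj]; rewrite !mxE /= ?subrr ?subr0.
by rewrite addmx_sub // eqmx_opp.
Qed.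

(** If r < 3 s then three conjugates are dependent, so P contains (1, 0, 0, 0) and
(0, 1, 0, 0).  Their words (f, g) = (x, 0) and (0, y) have ten independent
conjugates, whence 10 <= r. *)
Lemma support_lower_bound s r (P : 'M[F32]_(s, 4)) (B : 'M[F2]_(r, 11)) :
    row_free P -> (P *m HBmat <= in_F32 B)%MS ->
  (minn 10 (3 * s) <= r)%N.
Proof.
move=> Pfree PB; rewrite geq_min orbC; case: (leqP (3 * s) r) => //= r3s.
have [u [u0 u3 uP]] := conjugate_dependency PB r3s isT.
have [e1P e2P] := three_conjugates Pfree u0 u3 uP.
pose Q : 'M_(2, 4) := \matrix_(i < 2) nth 0 [:: row4 1 0 0 0; row4 0 1 0 0] i.
have QB : (Q *m HBmat <= in_F32 B)%MS.
  apply: (submx_trans _ PB); apply/submxMr/row_subP => i.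
  by rewrite rowK; case: i => [[|[|i]] Hi].
rewrite leqNgt; apply/negP => r10.
have [w [[k k5 wk] _]] := conjugate_dependency QB (r10 : (r < 5 * 2)%N) isT.
have wQ k' : w k' *m map_mx (frob k') Q = row4 (w k' 0 0) (w k' 0 1) 0 0.
  apply/rowP => j; rewrite !mxE !big_ord_recl big_ord0 !mxE /=.
  rewrite [lift _ _](_ : _ = 1); last exact: val_inj.
  by case: j => [[|[|[|[|j]]]] Hj] //=; rewrite ?mxE /= ?rmorph0 ?rmorph1; ring.
under eq_bigr do rewrite wQ.
move/(@frob_relations (fun k => w k 0 0) (fun k => w k 0 1) (fun=> 0) (fun=> 0)).
case; rewrite !addr0 => -[a0 a1 a2 a3 a4] [b0 b1 b2 b3 b4] _.
case/eqP: wk; apply/rowP => j; rewrite mxE.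
have [->|->] : j = 0 \/ j = 1.
  by case: j => [[|[|j]] Hj] //; [left|right]; apply: val_inj.
- by case: k k5 => [|[|[|[|[|k]]]]].
- by case: k k5 => [|[|[|[|[|k]]]]].
Qed.

(** A root would satisfy t^8 = t, and t^32 = t then gives t^4 = t; but F8 and F32
only share F2, which contains no root. *)
Lemma cubic_no_root (t : F32) : t ^+ 3 != t ^+ 2 + 1.
Proof.
apply/eqP => t3.
have sqrD (x y : F32) : (x + y) ^+ 2 = x ^+ 2 + y ^+ 2.
  exact: (rmorphD (frob 1)).
have t4 : t ^+ 4 = t ^+ 2 + t + 1.
  by rewrite exprS t3 mulrDr mulr1 -exprS t3 addrAC.
have t8 : t ^+ 8 = t.
  rewrite (exprM t 4 2) t4 !sqrD expr1n -(exprM t 2 2) t4.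
  rewrite -[RHS]addr0 -[in RHS](addbb_F32 (t ^+ 2 + 1)); ring.
have /eqP := F32_expr32 t; rewrite (exprM t 8 4) t8 t4 -subr_eq0 addrAC addrK.
rewrite addr_eq0 (oppr_pchar2 pchar_F32) => /eqP t2.
move: t4; rewrite (exprM t 2 2) t2 expr1n addrAC addbb_F32 add0r => t1.
by move: t3; rewrite -t1 !expr1n addbb_F32 => /eqP; rewrite oner_eq0.
Qed.

Lemma cubic_form_eq0 (c d : F32) : c ^+ 2 * (c + d) = d ^+ 3 -> d = 0.
Proof.
move=> cd; apply/eqP/negPn/negP => d0.
have /eqP[] := cubic_no_root (c / d).
apply: (mulIf (expf_neq0 3 d0)); rewrite -exprMn divfK // mulrDl mul1r.
rewrite [X in _ * X + _]exprSr mulrA -exprMn divfK // -cd.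
by rewrite mulrDr addrCA addbb_F32 addr0 -exprSr.
Qed.

(** A word of rank at most 3 has four dependent conjugates q_k u^(k).  If q_3 = 0,
three conjugates are dependent and u would span a space containing two
independent vectors.  Otherwise the coefficients of x^16 in f and g read
q_3 c^8 = q_2 d^4 and q_3 d^8 = q_2 (c + d)^4; eliminating q_2 and q_3 gives the
fourth power of c^2 (c + d) = d^3, so d = 0, and then c, a and b vanish. *)
Lemma word_lower_bound r (u : 'rV[F32]_4) (B : 'M[F2]_(r, 11)) :
  u != 0 -> (u *m HBmat <= in_F32 B)%MS -> (4 <= r)%N.
Proof.
move=> u0 uB; rewrite leqNgt; apply/negP => r4.
have ufree : row_free u by rewrite /row_free rank_rV u0.
have [q [[k k4 qk] q4 quH]] :=
  conjugate_dependency uB (r4 : (r < 4 * 1)%N) isT.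
have [q3|q3] := eqVneq (q 3%N) 0.
  have q_ge3 j : (3 <= j)%N -> q j = 0.
    by rewrite leq_eqVlt => /orP[/eqP <- //|/q4].
  have q_lt3 : exists2 j, (j < 3)%N & q j != 0.
    exists k => //; rewrite ltnNge; apply: contraNN qk => /q_ge3 ->.
    exact: eqxx.
  have [/sub_rVP[x /rowP e1] /sub_rVP[y /rowP e2]] :=
    three_conjugates ufree q_lt3 q_ge3 quH.
  have := e1 (inord 0); have := e2 (inord 0); have := e2 (inord 1).
  rewrite !mxE !inordK //= => y1 /esym/eqP; rewrite mulf_eq0 => /orP[]/eqP z0.
    by move/eqP: y1; rewrite z0 mul0r oner_eq0.
  by move/eqP; rewrite z0 mulr0 oner_eq0.
have [a [b [c [d uE]]]] : exists a b c d, u = row4 a b c d.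
  by do 4!eexists; apply: row4_eta.
pose p j := q j 0 0.
have quE j : q j *m map_mx (frob j) u =
    row4 (p j * frob j a) (p j * frob j b) (p j * frob j c) (p j * frob j d).
  rewrite uE map_frob_row4 [q j]mx11_scalar mul_scalar_mx.
  by apply/rowP => -[[|[|[|[|i]]]] Hi]; rewrite !mxE.
move: quH; under eq_bigr do rewrite quE.
move/(@frob_relations (fun j => p j * frob j a) (fun j => p j * frob j b)
                      (fun j => p j * frob j c) (fun j => p j * frob j d)).
have p3 : p 3%N != 0.
  by apply: contraNneq q3 => p3; rewrite [q 3%N]mx11_scalar -/(p 3%N) p3 raddf0.
have -> : p 4%N = 0 by rewrite /p q4 // mxE.
rewrite /= !mul0r !addr0 !add0r => -[[_ _ _ ea ec] [_ _ _ eb ed] _].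
have d0 : d = 0.
  apply: (@cubic_form_eq0 c d); apply: (fmorph_inj (frob 2)).
  have frob3 x : frob 3 x = frob 2 x ^+ 2 by rewrite -frob_sqr (rmorphXn (frob 2)).
  rewrite (rmorphM (frob 2)) !(rmorphXn (frob 2)) (rmorphD (frob 2)) /=.
  move: ec ed; rewrite !frob3 -mulrDr.
  move: (frob 2 c) (frob 2 d) => c' d' /addr_eq0_F32 ec /addr_eq0_F32 ed.
  by apply: (mulfI p3); rewrite mulrA ec mulrAC -ed -mulrA -exprSr.
move: ea eb ec; rewrite d0 !rmorph0 !mulr0 !addr0 => ea eb /eqP.
rewrite mulf_eq0 (negPf p3) frob_eq0 /= => /eqP c0.
move: ea eb; rewrite c0 !rmorph0 !mulr0 !addr0 => /eqP + /eqP.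
rewrite !(mulf_eq0 (p 3%N)) (negPf p3) !frob_eq0 /= => /eqP a0 /eqP b0.
case/eqP: u0; rewrite uE a0 b0 c0 d0.
by apply/rowP => -[[|[|[|[|i]]]] Hi]; rewrite !mxE.
Qed.

(** * Arithmetic with sums of powers of omega *)

(** Elements of F32 do not reduce by computation.  For the explicit matrices they
are written as sums of powers of omega, given by lists of exponents, and
compared through their coordinates in the basis 1, ..., omega^4. *)
Definition omega_sum (l : seq nat) : F32 := \sum_(k <- l) omega ^+ k.

Definition bits5 := (bool * bool * bool * bool * bool)%type.

Definition of_bits (r : bits5) : F32 :=
  let: (a, b, c, d, e) := r in
  a%:R + b%:R * omega + c%:R * omega ^+ 2 + d%:R * omega ^+ 3 + e%:R * omega ^+ 4.

(** Multiplication by omega on coordinates, from omega^5 = omega^2 + 1. *)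
Definition mul_omega (r : bits5) : bits5 :=
  let: (a, b, c, d, e) := r in (e, a, b (+) e, c, d).

Definition add_bits (r s : bits5) : bits5 :=
  let: (a, b, c, d, e) := r in let: (a', b', c', d', e') := s in
  (a (+) a', b (+) b', c (+) c', d (+) d', e (+) e').

Definition omega_bits (l : seq nat) : bits5 :=
  foldr (fun k => add_bits (iter k mul_omega (true, false, false, false, false)))
    (false, false, false, false, false) l.

Lemma of_bits_mul_omega r : of_bits (mul_omega r) = omega * of_bits r.
Proof.
case: r => [[[[a b] c] d] e] /=; rewrite natr_addb.
transitivity (omega * (a%:R + b%:R * omega + c%:R * omega ^+ 2 + d%:R * omega ^+ 3)
  + e%:R * omega ^+ 5); last by ring.
by rewrite omega5; ring.
Qed.

Lemma of_bits_add r s : of_bits (add_bits r s) = of_bits r + of_bits s.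
Proof.
case: r s => [[[[a b] c] d] e] [[[[a' b'] c'] d'] e'] /=.
by rewrite !natr_addb; ring.
Qed.

Lemma omega_bitsK l : of_bits (omega_bits l) = omega_sum l.
Proof.
rewrite /omega_sum; elim: l => [|k l IH] /=; first by rewrite big_nil; ring.
rewrite big_cons of_bits_add IH; congr (_ + _).
elim: k => [|k IHk] /=; first by rewrite expr0; ring.
by rewrite of_bits_mul_omega IHk exprS.
Qed.

Lemma omega_sumM l l' :
  omega_sum l * omega_sum l' = omega_sum [seq (x + y)%N | x <- l, y <- l'].
Proof.
rewrite /omega_sum big_allpairs_dep big_distrlr /=.
by apply: eq_bigr => x _; apply: eq_bigr => y _; rewrite exprD.
Qed.

Lemma omega_sum_cat (I : Type) (s : seq I) (F : I -> seq nat) :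
  omega_sum (flatten [seq F k | k <- s]) = \sum_(k <- s) omega_sum (F k).
Proof. by rewrite /omega_sum big_flatten big_map. Qed.

Definition omega_mx m n (A : nat -> nat -> seq nat) : 'M[F32]_(m, n) :=
  \matrix_(i, j) omega_sum (A i j).

Definition omega_mx_mul n (A B : nat -> nat -> seq nat) i j : seq nat :=
  flatten [seq [seq (x + y)%N | x <- A i k, y <- B k j] | k <- iota 0 n].

Definition mx_bits m n (A : nat -> nat -> seq nat) : seq (seq bits5) :=
  mkseq (fun i => mkseq (fun j => omega_bits (A i j)) n) m.

Lemma omega_mxM m n p A B :
  omega_mx m n A *m omega_mx n p B = omega_mx m p (omega_mx_mul n A B).
Proof.
apply/matrixP => i j; rewrite !mxE omega_sum_cat.
have -> : iota 0 n = index_iota 0 n by rewrite /index_iota subn0.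
by rewrite big_mkord; apply: eq_bigr => k _; rewrite !mxE omega_sumM.
Qed.

Lemma omega_mx_eq m n A B :
  mx_bits m n A = mx_bits m n B -> omega_mx m n A = omega_mx m n B.
Proof.
move=> AB; apply/matrixP => i j; rewrite !mxE -!omega_bitsK; congr of_bits.
have := congr1 (fun T => nth (false, false, false, false, false) (nth [::] T i) j) AB.
by rewrite !nth_mkseq.
Qed.

Definition table_entry (T : seq (seq (seq nat))) i j : seq nat :=
  nth [::] (nth [::] T i) j.

Definition id_exponents (i j : nat) : seq nat := if i == j then [:: 0%N] else [::].

Lemma omega_mx1 n : omega_mx n n id_exponents = 1%:M.
Proof.
apply/matrixP => i j; rewrite !mxE /id_exponents -val_eqE /=.
by case: eqP => _; rewrite /omega_sum ?big_nil // big_seq1.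
Qed.

Lemma omega_mx_eq0 m n A :
  mx_bits m n A = mx_bits m n (fun _ _ => [::]) -> omega_mx m n A = 0.
Proof.
move/omega_mx_eq ->; apply/matrixP => i j.
by rewrite !mxE /omega_sum big_nil.
Qed.

Lemma tr_omega_mx m n A : (omega_mx m n A)^T = omega_mx n m (fun i j => A j i).
Proof. by apply/matrixP => i j; rewrite !mxE. Qed.

(** Linear independence of the rows is witnessed by m columns, listed in f, that form
an identity matrix; the default n of nth is the index of no column. *)
Lemma omega_mx_free m n A (f : seq nat) :
    mx_bits m m (omega_mx_mul n A (fun j k => id_exponents j (nth n f k))) =
    mx_bits m m id_exponents ->
  row_free (omega_mx m n A).
Proof.
move=> e; apply/row_freeP.
exists (omega_mx n m (fun j k => id_exponents j (nth n f k))).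
by rewrite omega_mxM (omega_mx_eq e) omega_mx1.
Qed.

Definition bit_mx m n (T : seq (seq nat)) : 'M[F2]_(m, n) :=
  \matrix_(i, j) (nth 0%N (nth [::] T i) j)%:R.

Definition bit_exponents (T : seq (seq nat)) i j : seq nat :=
  if nth 0%N (nth [::] T i) j is 0 then [::] else [:: 0%N].

Lemma in_F32_bit_mx m n T :
  all (all (leq^~ 1%N)) T ->
  in_F32 (bit_mx m n T) = omega_mx m n (bit_exponents T).
Proof.
move=> T1; apply/matrixP => i j; rewrite !mxE /bit_exponents /omega_sum.
have : (nth 0%N (nth [::] T i) j <= 1)%N.
  have [iT|iT] := ltnP i (size T); last by rewrite (nth_default [::] iT) nth_nil.
  have [jT|jT] := ltnP j (size (nth [::] T i)); last by rewrite nth_default.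
  by have /allP/(_ _ (mem_nth 0%N jT)) := allP T1 _ (mem_nth [::] iT).
case: (nth _ _ _) => [|[|//]] _; first by rewrite big_nil rmorph0.
by rewrite big_seq1 expr0 rmorph1.
Qed.

(** * The dual code is generated by HBmat *)

Definition R_table := [::
  [:: [:: 4; 2];       [:: 2; 1; 0];    [:: 4; 2; 1];    [::]];
  [:: [:: 4];          [:: 4; 3; 0];    [:: 4; 3; 2; 1]; [::]];
  [:: [:: 3; 1];       [:: 2];          [:: 4; 1];       [:: 1]];
  [:: [:: 3; 1];       [:: 3; 2; 1; 0]; [:: 2; 0];       [:: 2]];
  [:: [:: 4; 3; 1; 0]; [:: 4];          [:: 4; 2; 0];    [:: 3]];
  [:: [:: 4; 1; 0];    [:: 4];          [:: 4; 2; 1; 0]; [:: 4]];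
  [:: [:: 4; 0];       [:: 4];          [:: 2; 0];       [::]]]%N.

Definition c_exponents k : seq (seq nat) :=
  [:: [:: k]; [::]; [:: (2 * k)%N]; [:: (4 * k)%N]].
Definition d_exponents k : seq (seq nat) :=
  [:: [::]; [:: k]; [:: (4 * k)%N]; [:: (2 * k)%N; (4 * k)%N]].
Definition HB_table : seq (seq (seq nat)) :=
  [:: c_exponents 0; c_exponents 1; c_exponents 2; d_exponents 0; c_exponents 3;
      c_exponents 4; d_exponents 1; d_exponents 2; d_exponents 3; d_exponents 4;
      [:: [::]; [::]; [:: 0%N]; [::]]].

Definition HB_exponents i j := table_entry HB_table j i.

Lemma HBmatE : HBmat = omega_mx 4 11 HB_exponents.
Proof.
apply/matrixP => i j; rewrite !mxE /HB_exponents /table_entry.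
case: j => [[|[|[|[|[|[|[|[|[|[|[|j]]]]]]]]]]] Hj] //=;
  case: i => [[|[|[|[|i]]]] Hi] //=; rewrite /omega_sum ?big_cons ?big_nil ?addr0 //;
  by rewrite /xi -?exprM.
Qed.

Lemma RmatE : Rmat = omega_mx 7 4 (table_entry R_table).
Proof.
apply/matrixP => i j; rewrite !mxE /table_entry.
by case: i => [[|[|[|[|[|[|[|i]]]]]]] Hi] //=; case: j => [[|[|[|[|j]]]] Hj] //=;
  rewrite /omega_sum ?big_cons ?big_nil; ring.
Qed.

(** For G = [R I] and HBmat = [L M] the condition is L R^T = M. *)
Lemma HB_Gmat : HBmat *m Gmat^T = 0.
Proof.
have -> : Gmat^T = col_mx Rmat^T (1%:M : 'M_7).
  by have := tr_row_mx Rmat (1%:M : 'M_7); rewrite trmx1.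
transitivity (row_mx (lsubmx (HBmat : 'M_(4, 4 + 7))) (rsubmx (HBmat : 'M_(4, 4 + 7)))
              *m col_mx Rmat^T (1%:M : 'M_7)); first by rewrite hsubmxK.
rewrite mul_row_col mulmx1.
have -> : lsubmx (HBmat : 'M_(4, 4 + 7)) = omega_mx 4 4 HB_exponents.
  by rewrite HBmatE; apply/matrixP => i j; rewrite !mxE.
have -> : rsubmx (HBmat : 'M_(4, 4 + 7)) =
    omega_mx 4 7 (fun i j => HB_exponents i (4 + j)).
  by rewrite HBmatE; apply/matrixP => i j; rewrite !mxE.
have -> : Rmat^T = omega_mx 4 7 (fun i j => table_entry R_table j i).
  by rewrite RmatE; apply/matrixP => i j; rewrite !mxE.
rewrite omega_mxM [X in X + _](@omega_mx_eq _ _ _ (fun i j => HB_exponents i (4 + j))).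
  by apply/matrixP => i j; rewrite mxE addbb_F32 mxE.
by vm_compute.
Qed.

Lemma rank_Gmat : \rank Gmat = 7%N.
Proof.
apply/eqP; rewrite -/(row_free Gmat); apply/row_freeP.
exists (col_mx (0 : 'M_(4, 7)) 1%:M).
by have := mul_row_col Rmat 1%:M (0 : 'M_(4, 7)) 1%:M; rewrite mulmx0 mulmx1 add0r.
Qed.

Lemma HBmat_free : row_free HBmat.
Proof.
apply: inj_row_free => u uH; apply/eqP/negPn/negP => u0.
have uB : (u *m HBmat <= in_F32 (0 : 'M[F2]_(0, 11)))%MS by rewrite uH sub0mx.
by have := word_lower_bound u0 uB.
Qed.

Lemma dual_Gmat : (dual_code Gmat :=: HBmat)%MS.
Proof.
apply/eqmxP; rewrite /dual_code andbC -mxrank_leqif_eq; last first.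
  by apply/sub_kermxP/HB_Gmat.
by rewrite (eqnP HBmat_free) mxrank_ker mxrank_tr rank_Gmat.
Qed.

(** If w is a dependency over F2, the first two coordinates are F2-combinations of
the basis 1, ..., omega^4, which kills the coefficients of all columns c_i and
d_i, and the third one is then the coefficient of z. *)
Lemma HBmat_columns_free (w : 'rV[F2]_11) : in_F32 w *m HBmat^T = 0 -> w = 0.
Proof.
move=> wH; pose x i := in_alg F32 (w 0 (inord i)).
have frob_x k i : frob k (x i) = x i.
  by rewrite /x; case: (F2P (w 0 (inord i))) => ->; rewrite ?rmorph0 ?rmorph1.
have xsum (s : seq nat) : size s = 5%N -> (\sum_(i < 5) x s`_i * omega ^+ i = 0) ->
    forall i, (i < 5)%N -> x s`_i = 0.
  move=> s5 sx i i5; pose V := Vandermonde 5 (\row_(j < 5) frob j omega).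
  have yV : \row_i x s`_i *m V = 0.
    apply/rowP => j; rewrite !mxE.
    transitivity (frob j (\sum_(i < 5) x s`_i * omega ^+ i)).
      2: by rewrite sx rmorph0.
    rewrite rmorph_sum; apply: eq_bigr => k _.
    by rewrite !mxE rmorphM rmorphXn /= frob_x.
  have /rowP/(_ (Ordinal i5)) : \row_i x s`_i = 0 :> 'rV_5.
    by rewrite -[LHS](mulmxK vandermonde5_unit) yV mul0mx.
  by rewrite !mxE.
have wHE i : \sum_(j < 11) x j * HBmat i j = 0.
  transitivity ((in_F32 w *m HBmat^T) 0 i); last by rewrite wH mxE.
  rewrite mxE; apply: eq_bigr => j _.
  by rewrite /x inord_val [in_F32 w _ _]mxE [_^T _ _]mxE.
have xc : forall i, (i < 5)%N -> x [:: 0; 1; 2; 4; 5]%N`_i = 0.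
  apply: xsum => //; rewrite -[RHS](wHE (inord 0)).
  rewrite !big_ord_recl !big_ord0 !mxE !inordK //= /bump /= /xi /=; ring.
have xd : forall i, (i < 5)%N -> x [:: 3; 6; 7; 8; 9]%N`_i = 0.
  apply: xsum => //; rewrite -[RHS](wHE (inord 1)).
  rewrite !big_ord_recl !big_ord0 !mxE !inordK //= /bump /= /xi /=; ring.
have x10 : x 10 = 0.
  rewrite -[RHS](wHE (inord 2)) !big_ord_recl !big_ord0 !mxE !inordK //= /bump /=.
  rewrite (xc 0%N) // (xc 1%N) // (xc 2%N) // (xc 3%N) // (xc 4%N) //.
  rewrite (xd 0%N) // (xd 1%N) // (xd 2%N) // (xd 3%N) // (xd 4%N) //.
  ring.
apply/rowP => j; rewrite mxE; apply: (fmorph_inj (in_alg F32)); rewrite rmorph0.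
rewrite -[j]inord_val -/(x j).
by case: j => [[|[|[|[|[|[|[|[|[|[|[|j]]]]]]]]]]] Hj] //=;
  [exact: (xc 0%N)|exact: (xc 1%N)|exact: (xc 2%N)|exact: (xd 0%N)|exact: (xc 3%N)
  |exact: (xc 4%N)|exact: (xd 1%N)|exact: (xd 2%N)|exact: (xd 3%N)|exact: (xd 4%N)].
Qed.

(** * Rank-weight hierarchy *)

Lemma HB_support s r (V : 'M[F32]_(s, 11)) (A : 'M[F2]_(r, 11)) :
  (V <= HBmat)%MS -> (V <= in_F32 A)%MS -> (minn 10 (3 * \rank V) <= r)%N.
Proof.
case/submxP => P -> PA; rewrite mxrankMfree ?HBmat_free //.
apply: (@support_lower_bound _ _ _ A (row_base_free P)).
by apply: submx_trans PA; rewrite submxMr // eq_row_base.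
Qed.

Lemma HB_word r (x : 'rV[F32]_11) (A : 'M[F2]_(r, 11)) :
  (x <= HBmat)%MS -> x != 0 -> (x <= in_F32 A)%MS -> (4 <= r)%N.
Proof.
case/submxP => u -> uH0; apply: word_lower_bound.
by apply: contraNneq uH0 => ->; rewrite mul0mx.
Qed.

Lemma HB_full_support r (A : 'M[F2]_(r, 11)) : (HBmat <= in_F32 A)%MS -> (11 <= r)%N.
Proof.
move=> HA; rewrite leqNgt; apply/negP => r11.
have : kermx A^T != 0.
  rewrite -mxrank_eq0 mxrank_ker mxrank_tr -lt0n subn_gt0.
  exact: leq_ltn_trans (rank_leq_row _) r11.
case/rowV0Pn => w /sub_kermxP wA /eqP[]; apply: HBmat_columns_free.
case/submxP: HA => Y ->.
by rewrite trmx_mul mulmxA map_trmx -map_mxM wA map_mx0 mul0mx.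
Qed.

(** An upper bound for a generalized weight: t independent relations over F2 between
the columns of P *m HBmat confine its support to dimension 11 - t. *)
Lemma HB_annihilated s t (P : 'M[F32]_(s, 4)) (W : 'M[F2]_(t, 11)) :
    row_free P -> row_free W -> P *m HBmat *m (in_F32 W)^T = 0 ->
  [/\ (P *m HBmat <= dual_code Gmat)%MS, \rank (P *m HBmat) = s,
      (P *m HBmat <= in_F32 (kermx W^T))%MS & \rank (kermx W^T) = (11 - t)%N].
Proof.
move=> Pfree Wfree PW; split.
- by rewrite dual_Gmat submxMl.
- by rewrite mxrankMfree ?HBmat_free //; apply/eqP.
- by rewrite map_kermx -map_trmx; apply/sub_kermxP.
by rewrite mxrank_ker mxrank_tr (eqP Wfree).
Qed.

(** The full support of D is the nondegeneracy of the columns of HBmat. *)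
Lemma gen_weight4 : gen_weight (dual_code Gmat) 4 = 11%N.
Proof.
apply: (@gen_weight_eq _ _ _ _ 4 _ _ HBmat 1%:M).
- move=> W r A; rewrite dual_Gmat => WH rW WA; apply: HB_full_support.
  apply: submx_trans WA; rewrite -(geq_leqif (mxrank_leqif_sup WH)) rW.
  exact: rank_leq_row.
- by rewrite dual_Gmat.
- exact/eqP/HBmat_free.
- by rewrite map_mx1 submx1.
exact: rank_leq_row.
Qed.

(** Two vectors over F2 which HBmat maps to F32-multiples of the same vector
p = (1, omega^3 + omega + 1, omega^4 + omega^2 + omega + 1,
     omega^4 + omega^3 + omega + 1),
namely to (omega^2 + 1) p and (omega^3 + 1) p. *)
Definition point_bits := [::
  [:: 1; 0; 1; 0; 0; 0; 1; 0; 0; 0; 0];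
  [:: 1; 0; 0; 1; 1; 0; 0; 0; 1; 1; 1]]%N.

Lemma bit_mx_free m n T (f : seq nat) :
    all (all (leq^~ 1%N)) T ->
    mx_bits m m (omega_mx_mul n (bit_exponents T)
                   (fun j k => id_exponents j (nth n f k))) =
    mx_bits m m id_exponents ->
  row_free (bit_mx m n T).
Proof.
move=> T1 e; rewrite /row_free -(mxrank_map (in_alg F32)) in_F32_bit_mx //.
exact: (omega_mx_free e).
Qed.

Lemma point_bits_free : row_free (bit_mx 2 11 point_bits).
Proof. by apply: (@bit_mx_free _ _ _ [:: 2; 3]%N); vm_compute. Qed.

Lemma gen_weight3 : gen_weight (dual_code Gmat) 3 = 9%N.
Proof.
(* The rows of P span the orthogonal complement of p. *)
pose P := omega_mx 3 4 (table_entry [::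
  [:: [:: 0; 1; 3];    [:: 0]; [::];   [::]];
  [:: [:: 0; 1; 2; 4]; [::];   [:: 0]; [::]];
  [:: [:: 0; 1; 3; 4]; [::];   [::];   [:: 0]]]%N).
have [||VD rV VW rW] := @HB_annihilated _ _ P _ _ point_bits_free.
- by apply: (@omega_mx_free _ _ _ [:: 1; 2; 3]%N); vm_compute.
- rewrite in_F32_bit_mx // HBmatE omega_mxM.
  by rewrite tr_omega_mx omega_mxM; apply: omega_mx_eq0; vm_compute.
apply: gen_weight_eq VD rV VW _ => [W r A WD rW' WA|]; last by rewrite rW.
by have := HB_support _ WA; rewrite rW'; apply; rewrite -dual_Gmat.
Qed.

(** For a vector over F2 let X and Y be the combinations of the xi's with its
coefficients at the columns c_i and d_i, and e its coefficient at z.  It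
annihilates the two words when X^2 + Y + Y^4 + e = 0 and
X^4 + X + Y^4 + Y^2 + Y = 0.  The solutions are X = Y^2 + Y^16 + e with Y of trace 0:
the first four rows of W come from the basis omega, omega^2, omega^4, 1 + omega^3
of the trace-zero elements, and the last one from (X, Y, e) = (1, 0, 1). *)
Lemma gen_weight2 : gen_weight (dual_code Gmat) 2 = 6%N.
Proof.
pose P := omega_mx 2 4 (table_entry [::
  [:: [::];   [:: 0]; [:: 0]; [::]];
  [:: [:: 0]; [:: 0]; [::];   [:: 0]]]%N).
pose W := [::
  [:: 1; 1; 1; 0; 1; 1; 1; 0; 0; 0; 0];
  [:: 0; 1; 0; 0; 0; 1; 0; 1; 0; 0; 0];
  [:: 1; 0; 0; 0; 1; 0; 0; 0; 0; 1; 0];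
  [:: 1; 0; 0; 1; 1; 1; 0; 0; 1; 0; 0];
  [:: 1; 0; 0; 0; 0; 0; 0; 0; 0; 0; 1]]%N.
have [|||VD rV VW rW] := @HB_annihilated _ _ P (bit_mx 5 11 W).
- by apply: (@omega_mx_free _ _ _ [:: 2; 3]%N); vm_compute.
- by apply: (@bit_mx_free _ _ _ [:: 6; 7; 9; 3; 10]%N); vm_compute.
- rewrite in_F32_bit_mx // HBmatE omega_mxM tr_omega_mx omega_mxM.
  by apply: omega_mx_eq0; vm_compute.
apply: gen_weight_eq VD rV VW _ => [U r A UD rU UA|]; last by rewrite rW.
by have := HB_support _ UA; rewrite rU; apply; rewrite -dual_Gmat.
Qed.

(** The word with f = x + x^4 and g = y^2 + y^4, whose entries have trace 0 and hence
lie in the span of omega, omega^2, omega^4 and 1 + omega^3. *)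
Definition trace_coefs : 'rV[F32]_4 :=
  omega_mx 1 4 (table_entry [:: [:: [:: 0]; [::]; [::]; [:: 0]]]%N).
Definition trace_word : 'rV[F32]_11 := trace_coefs *m HBmat.

Definition trace_bits := [::
  [:: 0; 1; 0; 0; 1; 1; 0; 0; 0; 1; 0];
  [:: 0; 0; 0; 0; 1; 0; 1; 1; 1; 1; 0];
  [:: 0; 1; 0; 0; 0; 0; 1; 1; 0; 1; 0];
  [:: 0; 0; 1; 0; 0; 1; 0; 1; 0; 0; 0]]%N.

Lemma trace_word_sub : (trace_word <= in_F32 (bit_mx 4 11 trace_bits))%MS.
Proof.
apply/submxP.
exists (omega_mx 1 4 (table_entry [:: [:: [:: 1]; [:: 2]; [:: 4]; [:: 0; 3]]]%N)).
rewrite in_F32_bit_mx; last by [].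
rewrite /trace_word /trace_coefs HBmatE !omega_mxM.
by apply: omega_mx_eq; vm_compute.
Qed.

Lemma trace_word_neq0 : trace_word != 0.
Proof.
rewrite mulmx_free_eq0 ?HBmat_free // -mxrank_eq0.
suff /eqP -> : row_free trace_coefs by [].
by apply: (@omega_mx_free _ _ _ [:: 0]%N); vm_compute.
Qed.

Lemma gen_weight1 : gen_weight (dual_code Gmat) 1 = 4%N.
Proof.
apply: gen_weight_eq (trace_word_sub) _ => [W r A WD rW WA|||].
- have /rowV0Pn[x xW x0] : W != 0 by rewrite -mxrank_eq0 rW.
  apply: HB_word x0 (submx_trans xW WA).
  by rewrite -dual_Gmat (submx_trans xW).
- by rewrite dual_Gmat submxMl.
- by rewrite rank_rV trace_word_neq0.
exact: rank_leq_row.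
Qed.

Lemma min_dist_dual : min_dist (dual_code Gmat) = 4%N.
Proof.
apply: min_dist_eq trace_word_neq0 trace_word_sub => [x r A xD x0 xA|].
  by apply: HB_word x0 xA; rewrite -dual_Gmat.
by rewrite dual_Gmat submxMl.
Qed.

Lemma Gmat_kermx : (Gmat :=: kermx HBmat^T)%MS.
Proof.
apply/eqmxP; rewrite -mxrank_leqif_eq.
  by rewrite mxrank_ker mxrank_tr (eqP HBmat_free) rank_Gmat.
by apply/sub_kermxP/trmx_inj; rewrite trmx_mul trmxK HB_Gmat trmx0.
Qed.

Lemma Gmat_annihilated (w : 'rV[F2]_11) : (in_F32 w <= Gmat)%MS -> w = 0.
Proof. by rewrite Gmat_kermx => /sub_kermxP/HBmat_columns_free. Qed.

(** A word of rank 1 is a multiple of a vector over F2, and C contains no nonzero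
one.  The two multiples of p above cancel in a word of rank 2, where
omega^2 + omega^4 = (omega^2 + 1) / (omega^3 + 1). *)
Lemma min_dist_Gmat : min_dist Gmat = 2%N.
Proof.
pose y := omega_mx 1 2 (table_entry [:: [:: [:: 0]; [:: 2; 4]]]%N).
pose x := y *m in_F32 (bit_mx 2 11 point_bits).
apply: (@min_dist_eq _ _ _ _ x (bit_mx 2 11 point_bits)).
- move=> z r A zC z0 /submxP[c zE]; rewrite ltnNge; apply/negP => r1.
  case/eqP: z0; rewrite zE; case: r r1 A c zE => [|[|//]] _ A c zE.
    by rewrite thinmx0 mul0mx.
  move: zC; rewrite zE [c]mx11_scalar mul_scalar_mx => zC.
  have [-> | c0] := eqVneq (c 0 0) 0; first by rewrite scale0r.
  rewrite (@Gmat_annihilated A) ?map_mx0 ?scaler0 //.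
  by rewrite -(eqmx_scale _ c0).
- rewrite Gmat_kermx; apply/sub_kermxP.
  rewrite /x in_F32_bit_mx; last by [].
  rewrite HBmatE tr_omega_mx !omega_mxM.
  by apply: omega_mx_eq0; vm_compute.
- rewrite mulmx_free_eq0; last by rewrite /row_free mxrank_map; apply: point_bits_free.
  rewrite -mxrank_eq0; suff /eqP -> : row_free y by [].
  by apply: (@omega_mx_free _ _ _ [:: 0]%N); vm_compute.
exact: submxMl.
Qed.

(** * Nondegeneracy, quasi-MRD property and scatteredness *)

Lemma nondegenerateP s n (C : 'M[F32]_(s, n)) :
  (forall w : 'rV[F2]_n, in_F32 w *m C^T = 0 -> w = 0) -> nondegenerate_code C.
Proof.
move=> Cw; exists (row_base C).
  by split; [exact: row_base_free | exact: eq_row_base].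
apply/free_columnsP => w wC; apply: Cw.
have /submxP[Y ->] : (C <= row_base C)%MS by rewrite eq_row_base.
by rewrite trmx_mul mulmxA wC mul0mx.
Qed.

Lemma Gmat_columns_free (w : 'rV[F2]_11) : in_F32 w *m Gmat^T = 0 -> w = 0.
Proof.
move=> wG; apply: contra_eq (erefl true) => w0.
have wD : (in_F32 w <= HBmat)%MS by rewrite -dual_Gmat; apply/sub_kermxP.
have w0' : in_F32 w != 0 by rewrite map_mx_eq0.
by have := HB_word wD w0' (submx_refl _).
Qed.

Lemma quasi_MRD_Gmat : quasi_MRD Gmat.
Proof.
split=> //; rewrite rank_Gmat min_dist_Gmat.
by rewrite (_ : Num.ceil _ = 4); last exact/Num.Theory.ceil_def.
Qed.

Lemma quasi_MRD_dual : quasi_MRD (dual_code Gmat).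
Proof.
split=> //; rewrite dual_Gmat (eqP HBmat_free) min_dist_dual.
by rewrite (_ : Num.ceil _ = 2); last exact/Num.Theory.ceil_def.
Qed.

Lemma Gmat_system : is_system 11 (column_system Gmat).
Proof.
split.
  have /free_columnsP := Gmat_columns_free; rewrite /free => /eqP ->.
  by rewrite size_map -cardE card_ord.
rewrite -sub1mx; apply/row_subP => i.
rewrite (sumsmx_sup (column Gmat (rshift 4 i))) //.
  by apply/memv_span/mapP; exists (rshift 4 i); rewrite ?mem_enum.
rewrite genmxE.
suff -> : to_row (column Gmat (rshift 4 i)) = row i 1%:M by exact: submx_refl.
have e j := row_mxEr Rmat (1%:M : 'M_7) j i.
by apply/rowP => j; rewrite !mxE ffunE [LHS]e !mxE eq_sym.
Qed.

(** Vectors of the system are the products of the transposed generator matrix with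
vectors over F2. *)
Lemma sub_column_system k n s (G : 'M[F32]_(k, n)) (u : s.-tuple (F32vec k)) :
    {subset u <= column_system G} ->
  exists W : 'M[F2]_(s, n), forall i, to_row (tnth u i) = row i (in_F32 W) *m G^T.
Proof.
move=> uG; pose T := map_tuple (column G) (ord_tuple n).
exists (\matrix_(i, j) coord T j (tnth u i)) => i.
have uiG : tnth u i \in <<T>>%VS by apply: uG; apply: mem_tnth.
apply/rowP => a; rewrite mxE [LHS](congr1 (fun v : F32vec k => v a) (coord_span uiG)).
rewrite sum_ffunE mxE; apply: eq_bigr => j _.
by rewrite !ffunE -tnth_nth tnth_map tnth_ord_tuple ffunE !mxE mulrC mulr_in_F32.
Qed.

Lemma to_row_comb k s (c : 'I_s -> F2) (u : 'I_s -> F32vec k) :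
  to_row (\sum_i c i *: u i) = in_F32 (\row_i c i) *m \matrix_i to_row (u i).
Proof.
apply/rowP => a; rewrite !mxE sum_ffunE; apply: eq_bigr => i _.
by rewrite !mxE ffunE mulrC mulr_in_F32.
Qed.

(** Three independent vectors W G^T in a plane satisfy a relation y W G^T = 0, and
y W is then a word of D supported on the three rows of W. *)
Lemma Gmat_scattered : scattered 2 (column_system Gmat).
Proof.
move=> H rH; set S := (_ :&: _)%VS; rewrite leqNgt; apply/negP => S3.
pose b := take 3 (vbasis S).
have sb : size b == 3%N by apply/eqP/size_takel; rewrite size_tuple.
have bfree : free (Tuple sb).
  have := basis_free (vbasisP S); rewrite -[X in free X](cat_take_drop 3).
  exact: catl_free.
have bS : {subset Tuple sb <= S} by move=> v /mem_take /vbasis_mem.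
have [|W WE] := @sub_column_system _ _ _ Gmat (Tuple sb).
  by move=> v /bS; rewrite memv_cap => /andP[].
pose M := in_F32 W *m Gmat^T.
have bE i : to_row (tnth (Tuple sb) i) = row i M by rewrite WE row_mul.
have MH : (M <= H)%MS.
  apply/row_subP => i; rewrite -bE -mem_F2_restrict.
  by have /bS := mem_tnth i (Tuple sb); rewrite memv_cap => /andP[].
have Wfree : row_free W.
  apply: inj_row_free => w wW.
  suff w0 : forall i, w 0 i = 0 by apply/rowP => i; rewrite mxE w0.
  apply: (freeP bfree); apply/ffunP => a.
  transitivity (to_row (\sum_i w 0 i *: (Tuple sb)`_i) 0 a); first by rewrite mxE.
  rewrite to_row_comb (_ : \matrix_i _ = M).
    have -> : \row_i w 0 i = w by apply/rowP => i; rewrite mxE.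
    by rewrite mulmxA -map_mxM wW map_mx0 mul0mx !mxE ffunE.
  by apply/row_matrixP => i; rewrite rowK -bE (tnth_nth 0).
have : kermx M != 0.
  rewrite -mxrank_eq0 mxrank_ker -lt0n subn_gt0.
  by apply: leq_ltn_trans (mxrankS MH) _; rewrite rH.
case/rowV0Pn => y /sub_kermxP; rewrite mulmxA => yM y0.
have yW : y *m in_F32 W != 0 by rewrite mulmx_free_eq0 // /row_free mxrank_map.
have yD : (y *m in_F32 W <= HBmat)%MS by rewrite -dual_Gmat; apply/sub_kermxP.
by have := HB_word yD yW (submxMl _ _).
Qed.

(** * Invariance under equivalence and direct sums *)

(** The inequality d <= d_j for all j >= i, phrased through generators of supports so
that it also applies to codes given with any number of rows. *)
Definition weight_bound t n (E : 'M[F32]_(t, n)) (i d : nat) : Prop :=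
  forall s r (V : 'M[F32]_(s, n)) (B : 'M[F2]_(r, n)),
  (V <= E)%MS -> (V <= in_F32 B)%MS -> (i <= \rank V)%N -> (d <= r)%N.

Lemma dual_Gmat_bounds (D := dual_code Gmat) :
  [/\ weight_bound D 1 4, weight_bound D 2 6 & weight_bound D 3 9].
Proof.
split=> s r V B; rewrite dual_Gmat => VD VB rV.
- have /rowV0Pn[x xV x0] : V != 0 by rewrite -mxrank_eq0 -lt0n.
  exact: HB_word (submx_trans xV VD) x0 (submx_trans xV VB).
- apply: leq_trans (HB_support VD VB); rewrite leq_min /=; lia.
apply: leq_trans (HB_support VD VB); rewrite leq_min /=; lia.
Qed.

(** Both equivalences are of this form: V |-> f^-1 (V A) maps subcodes of E to
subcodes of D and supports B to B A. *)
Lemma weight_bound_transport t t' n (D : 'M[F32]_(t, n)) (E : 'M[F32]_(t', n))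
    (A : 'M[F2]_n) (f : {rmorphism F32 -> F32}) i d :
    A \in unitmx ->
    (forall s (V : 'M[F32]_(s, n)), (V <= E)%MS ->
       exists2 W : 'M[F32]_(s, n), (W <= D)%MS & map_mx f W = V *m in_F32 A) ->
  weight_bound D i d -> weight_bound E i d.
Proof.
move=> Aunit DE wD s r V B VE VB iV; have [W WD fW] := DE _ _ VE.
have rW : \rank W = \rank V.
  rewrite -(mxrank_map f) fW mxrankMfree // row_free_unit.
  by rewrite map_unitmx.
apply: (wD _ _ W (B *m A) WD); last by rewrite rW.
by rewrite -(map_submx f) fW map_in_F32 map_mxM submxMr.
Qed.

(** The matrix that embeds words on a block of coordinates, extending them by 0. *)
Definition coord_incl n1 n (g : 'I_n1 -> 'I_n) : 'M[F2]_(n1, n) :=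
  \matrix_(a, j) (g a == j)%:R.

Lemma mul_coord_incl n1 n s (g : 'I_n1 -> 'I_n) (Y : 'M[F32]_(s, n1)) i b :
  injective g -> (Y *m in_F32 (coord_incl g)) i (g b) = Y i b.
Proof.
move=> ginj; rewrite mxE (bigD1 b) //= !mxE eqxx rmorph1 mulr1 big1 ?addr0 // => a ab.
by rewrite !mxE (inj_eq ginj) (negPf ab) rmorph0 mulr0.
Qed.

Lemma mul_coord_incl0 n1 n s (g : 'I_n1 -> 'I_n) (Y : 'M[F32]_(s, n1)) i j :
  (forall a, g a != j) -> (Y *m in_F32 (coord_incl g)) i j = 0.
Proof.
by move=> gj; rewrite mxE big1 // => a _; rewrite !mxE (negPf (gj a)) rmorph0 mulr0.
Qed.

(** The words of the first summand, extended by 0, are supported on n1 coordinates. *)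
Lemma direct_sum_block n n1 n2 (E : 'M[F32]_n) (f : 'I_n1 + 'I_n2 -> 'I_n) D1 D2 i d :
  direct_sum E f D1 D2 -> weight_bound E i d -> (i <= \rank D1)%N -> (d <= n1)%N.
Proof.
case=> /bij_inj finj ED wE iD.
have inl_inj : injective (f \o inl) by move=> a b /finj[].
pose J := coord_incl (f \o inl).
apply: (wE _ _ (D1 *m in_F32 J) J); last 2 first.
- exact: submxMl.
- rewrite mxrankMfree //; apply: inj_row_free => y yJ.
  by apply/rowP => b; rewrite -(mul_coord_incl y 0 b inl_inj) yJ !mxE.
apply/row_subP => k; rewrite row_mul ED; apply/andP; split.
  rewrite (_ : colsub _ _ = row k D1) ?row_sub //.
  by apply/rowP => b; rewrite [LHS]mxE (mul_coord_incl _ 0 b inl_inj).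
rewrite (_ : colsub _ _ = 0) ?sub0mx //.
apply/rowP => b; rewrite [LHS]mxE mul_coord_incl0 ?mxE // => a.
by apply/eqP => /finj.
Qed.

Definition sum_swap (A B : Type) (t : A + B) : B + A :=
  match t with inl a => inr a | inr b => inl b end.

Lemma direct_sum_sym n n1 n2 (E : 'M[F32]_n) (f : 'I_n1 + 'I_n2 -> 'I_n) D1 D2 :
  direct_sum E f D1 D2 -> direct_sum E (f \o @sum_swap _ _) D2 D1.
Proof.
case=> fbij ED; split; last by move=> x; rewrite ED andbC.
by apply: bij_comp fbij _; exists (@sum_swap _ _) => -[].
Qed.

Lemma direct_sum_rank n n1 n2 (E : 'M[F32]_n) (f : 'I_n1 + 'I_n2 -> 'I_n) D1 D2 :
  direct_sum E f D1 D2 -> (\rank E <= \rank D1 + \rank D2)%N.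
Proof.
case=> fbij ED; have finj := bij_inj fbij.
have inl_inj : injective (f \o inl) by move=> a b /finj[].
have inr_inj : injective (f \o inr) by move=> a b /finj[].
pose J1 := coord_incl (f \o inl); pose J2 := coord_incl (f \o inr).
apply: (@leq_trans (\rank (D1 *m in_F32 J1 + D2 *m in_F32 J2)%MS)); last first.
  by apply: leq_trans (mxrank_adds_leqif _ _) _; rewrite leq_add ?mxrankM_maxl.
apply/mxrankS/row_subP => k; have := row_sub k E; rewrite ED => /andP[x1 x2].
set x := row k E in x1 x2 *.
have -> : x = colsub (f \o inl) x *m in_F32 J1 + colsub (f \o inr) x *m in_F32 J2.
  apply/rowP => j; rewrite [RHS]mxE; case: fbij => g _ fg.
  rewrite -(fg j); case: (g j) => b.
    rewrite [X in X + _](mul_coord_incl _ 0 b inl_inj).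
    rewrite mul_coord_incl0 ?addr0 ?mxE // => a.
    by apply/eqP => /finj.
  rewrite [X in _ + X](mul_coord_incl _ 0 b inr_inj).
  rewrite mul_coord_incl0 ?add0r ?mxE // => a.
  by apply/eqP => /finj.
by rewrite addmx_sub_adds // submxMr.
Qed.

(** If the dimensions are 2 and 2 both blocks need 6 coordinates; if one of them is
at least 3, its block needs 9 and the other one 4. *)
Lemma not_direct_sum (E : 'M[F32]_11) :
    \rank E = 4%N -> weight_bound E 1 4 -> weight_bound E 2 6 -> weight_bound E 3 9 ->
  ~ nontrivial_direct_sum E.
Proof.
move=> rE w1 w2 w3 [n1 [n2 [f [D1 [D2 [_ _ r1 r2 ds]]]]]].
have n12 : (n1 + n2 = 11)%N.
  by case: ds => /bij_eq_card; rewrite card_sum !card_ord.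
have := direct_sum_rank ds; rewrite rE => r12.
have ds' := direct_sum_sym ds.
have b1 := direct_sum_block ds w1; have b1' := direct_sum_block ds' w1.
have b2 := direct_sum_block ds w2; have b2' := direct_sum_block ds' w2.
have b3 := direct_sum_block ds w3; have b3' := direct_sum_block ds' w3.
lia.
Qed.

(** One of the two blocks has length 5 and carries a 2-dimensional subcode. *)
Lemma order_one_not_weight_bound s1 s2 (E : 'M[F32]_11) :
  (s1 + s2 = 1)%N -> order_one_direct_sum s1 s2 E -> ~ weight_bound E 2 6.
Proof.
move=> s12 [f [D1 [D2 [_ [r1 _] _ [r2 _] ds]]]] w2.
have := direct_sum_block ds w2; have := direct_sum_block (direct_sum_sym ds) w2.
rewrite r1 r2 /m; lia.
Qed.

Lemma code_equiv_bounds n (D E : 'M[F32]_n) i d :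
  code_equiv D E -> weight_bound D i d -> weight_bound E i d.
Proof.
case=> A [f [Aunit [g gK fK] EDA]].
apply: (weight_bound_transport (A := invmx A) (f := f)); first by rewrite unitmx_inv.
move=> s V; rewrite EDA => /submxP[Y ->].
exists (map_mx g Y *m D); first exact: submxMl.
rewrite map_mxM -map_mx_comp (_ : map_mx _ Y = Y); last first.
  by apply/matrixP => a b; rewrite mxE /= fK.
by rewrite map_invmx -!mulmxA mulmxV ?map_unitmx // mulmx1.
Qed.

(** The generator matrix G' of the second system satisfies G' = A f(G) W^T for an
invertible W over F2.  Hence V G'^T = 0 if and only if V W is orthogonal to f(G), so
that V |-> f^-1 (V W) maps E into the dual of the row space of G. *)
Lemma system_equiv_bounds k n s (G : 'M[F32]_(k, n)) (E : 'M[F32]_(s, n))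
    (U' : {vspace F32vec k}) i d :
    system_equiv (column_system G) U' -> associated_system (dual_code E) U' ->
  weight_bound (dual_code G) i d -> weight_bound E i d.
Proof.
case=> A [f [Aunit [g gK fK] UU']] [G' [[_ G'E] G'free U'E]].
have colU j : exists2 u, u \in column_system G & column G' j = semilinear_act A f u.
  by apply/UU'; rewrite U'E; apply/memv_span/mapP; exists j; rewrite ?mem_enum.
have [u uG uE] := fin_all_exists2 colU.
have [|W WE] := @sub_column_system _ _ _ G (map_tuple u (ord_tuple n)).
  by move=> v /mapP[j _ ->].
have G'W : G'^T = in_F32 W *m map_mx f G^T *m A^T.
  apply/row_matrixP => j; rewrite !row_mul.
  have -> : row j (in_F32 W) *m map_mx f G^T = map_mx f (to_row (u j)).
    have := WE j; rewrite tnth_map tnth_ord_tuple => ->.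
    by rewrite map_mxM map_row map_in_F32.
  apply/rowP => a; have /ffunP/(_ a) := uE j; rewrite !ffunE !mxE => ->.
  by apply: eq_bigr => b _; rewrite !mxE mulrC.
have Wunit : W \in unitmx.
  rewrite -row_free_unit; apply: inj_row_free => w wW.
  apply: (free_columnsP _ G'free).
  by rewrite G'W !mulmxA -map_mxM wW map_mx0 !mul0mx.
apply: (weight_bound_transport (A := W) (f := f) Wunit) => t V VE.
have VG' : V *m G'^T = 0.
  case/submxP: VE => Y ->; rewrite -mulmxA.
  suff -> : E *m G'^T = 0 by rewrite mulmx0.
  have /sub_kermxP G'E0 : (G' <= kermx E^T)%MS by rewrite G'E.
  by apply: trmx_inj; rewrite trmx_mul trmxK trmx0.
exists (map_mx g (V *m in_F32 W)); last first.
  by apply/matrixP => a b; rewrite mxE [in LHS]mxE fK.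
apply/sub_kermxP/eqP; rewrite -(map_mx_eq0 f) map_mxM -map_mx_comp.
rewrite (_ : map_mx _ (V *m _) = V *m in_F32 W); last first.
  by apply/matrixP => a b; rewrite mxE /= fK.
have := VG'; rewrite G'W !mulmxA => /eqP; rewrite mulmx_free_eq0 //.
by rewrite row_free_unit unitmx_tr.
Qed.

Theorem corollary4p4 :
  let U := column_system Gmat in
  let C := Gmat in
  let D := dual_code C in
  [/\ extremal_scattered 2 11 U,
      [/\ nondegenerate_code C, is_code 7 2 C & quasi_MRD C],
      [/\ (D :=: HBmat)%MS, nondegenerate_code D, is_code 4 4 D, quasi_MRD D &
          (gen_weight D 1, gen_weight D 2, gen_weight D 3, gen_weight D 4)
            = (4, 6, 9, 11)%N] &
      (forall (s1 s2 : nat) (E : 'M[F32]_11) (U' : {vspace F32vec 7}),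
          (s1 + s2 = 1)%N -> order_one_direct_sum s1 s2 E ->
          associated_system (dual_code E) U' -> ~ system_equiv U U')
      /\ (forall E : 'M[F32]_11, nontrivial_direct_sum E -> ~ code_equiv D E)].
Proof.
have [w1 w2 w3] := dual_Gmat_bounds; split.
- by split; [exact: Gmat_system | exact: Gmat_scattered |].
- split; [exact/nondegenerateP/Gmat_columns_free | | exact: quasi_MRD_Gmat].
  by split; [exact: rank_Gmat | exact: min_dist_Gmat].
- split; [exact: dual_Gmat | | | exact: quasi_MRD_dual |].
  + apply: nondegenerateP => w wD; apply: HBmat_columns_free.
    have /submxP[Y ->] : (HBmat <= dual_code Gmat)%MS by rewrite dual_Gmat.
    by rewrite trmx_mul mulmxA wD mul0mx.
  + by split; [rewrite dual_Gmat; apply/eqP/HBmat_free | exact: min_dist_dual].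
  by rewrite gen_weight1 gen_weight2 gen_weight3 gen_weight4.
split=> [s1 s2 E U' s12 E12 EU' UU'|E Esum DE].
  by apply: (order_one_not_weight_bound s12 E12); apply: system_equiv_bounds UU' EU' w2.
have Ebound i d : weight_bound (dual_code Gmat) i d -> weight_bound E i d.
  exact: code_equiv_bounds DE.
apply: (not_direct_sum _ (Ebound _ _ w1) (Ebound _ _ w2) (Ebound _ _ w3) Esum).
case: DE => A [f [Aunit _ ->]].
rewrite mxrankMfree ?row_free_unit ?map_unitmx // mxrank_map dual_Gmat.
exact/eqP/HBmat_free.
Qed.
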